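(* Let $\Gamma$ be a countable discrete infinite amenable group, and $X$ a compact metrizable space with $\Gamma\curvearrowright X$ by homeomorphisms. Let $\rho$ be a dynamically generating continuous pseudometric on $X$. Let $1\le p<\infty$, and let $(F_n)_{n=1}^\infty$ be a F\o lner sequence for $\Gamma$. Define $\rho_{F_n,p}$ on $X$ by $$\rho_{F_n,p}(x,y)^p=\frac{1}{|F_n|}\sum_{g\in F_n}\rho(gx,gy)^p.$$ Then $$\operatorname{mdim}_p(X,\rho)=\liminf_{\varepsilon\to0}\limsup_{n\to\infty}\frac{\log S_\varepsilon(X,\rho_{F_n,p})}{|F_n|\log(1/\varepsilon)}.$$ In particular, the right-hand side is independent of the choice of F\o lner sequence.
   Context: A F\o lner sequence is a sequence of nonempty finite sets $F_n\subseteq\Gamma$ with $|gF_n\Delta F_n|/|F_n|\to0$ for all $g\in\Gamma$. A continuous pseudometric $\rho$ on $X$ is dynamically generating if for all $x\ne y$ there is $g\in\Gamma$ with $\rho(gx,gy)>0$. For a pseudometric space $(Y,d)$, $S_\varepsilon(Y,d)$ is the smallest cardinality of an $\varepsilon$-dense subset of $Y$. A sofic approximation of $\Gamma$ is a sequence $\Sigma$ of maps $\sigma_i\colon\Gamma\to S_{d_i}$ with $d_i\to\infty$ such that $\frac{1}{d_i}|\{k:\sigma_i(g)\sigma_i(h)(k)=\sigma_i(gh)(k)\}|\to1$ for all $g,h$ and $\frac{1}{d_i}|\{k:\sigma_i(g)(k)\neq\sigma_i(h)(k)\}|\to1$ for all $g\ne h$. On $X^k$ let $\rho_p(x,y)=(\frac1k\sum_{j=1}^k\rho(x_j,y_j)^p)^{1/p}$.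 For $F\subseteq\Gamma$ finite and $\delta>0$, $\mathrm{Map}(\rho,F,\delta,\sigma_i)$ is the set of maps $\phi\colon\{1,\dots,d_i\}\to X$ with $\rho_2(\phi\circ\sigma_i(g),g\phi)<\delta$ for all $g\in F$. Set $$\operatorname{mdim}_{\Sigma,p}(X,\rho)=\liminf_{\varepsilon\to0}\ \inf_{F,\delta}\ \limsup_{i\to\infty}\frac{\log S_\varepsilon(\mathrm{Map}(\rho,F,\delta,\sigma_i),\rho_p)}{d_i\log(1/\varepsilon)}$$ (infimum over finite $F\subseteq\Gamma$ and $\delta>0$). For amenable $\Gamma$ and $1\le p<\infty$ this quantity does not depend on $\Sigma$, and $\operatorname{mdim}_p(X,\rho)$ denotes the common value. *)

(* Defs.v *)
From HB Require Import structures.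
From mathcomp Require Import all_boot all_order all_algebra all_fingroup.
From mathcomp Require Import finmap.
From mathcomp Require Import all_classical all_reals all_analysis.

Set Implicit Arguments.
Unset Strict Implicit.
Unset Printing Implicit Defensive.

Import Order.TTheory GRing.Theory Num.Theory.
Import numFieldNormedType.Exports.

Local Open Scope classical_set_scope.
Local Open Scope ring_scope.

Definition is_pseudometric (R : realType) (T : Type) (d : T -> T -> R) : Prop :=
  [/\ forall x y, 0 <= d x y,
      forall x, d x x = 0,
      forall x y, d x y = d y x &
      forall x y z, d x z <= d x y + d y z].

Definition is_metric (R : realType) (T : Type) (d : T -> T -> R) : Prop :=
  is_pseudometric d /\ (forall x y, d x y = 0 -> x = y).

Definition metrizable (R : realType) (X : topologicalType) : Prop :=
  exists d : X -> X -> R, is_metric d /\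
    forall (x : X) (A : set X),
      nbhs x A <-> exists2 e : R, 0 < e & [set y | d x y < e] `<=` A.

Section Groups.
Context {R : realType} {G : groupType}.

Definition folner_sequence (F : nat -> {fset G}) : Prop :=
  (forall n, F n != fset0) /\
  forall g : G,
    (fun n => let gF := [fset (g * h)%g | h in F n]%fset in
       #|` ((gF `\` F n) `|` (F n `\` gF))%fset|%:R / #|` F n|%:R : R)
      @ \oo --> (0 : R).

(* Amenability in the form of the Folner criterion for countable groups. *)
Definition amenable : Prop := exists F : nat -> {fset G}, folner_sequence F.

(* The product of permutations is spelled out as a composition of maps because
   perm's [*] composes in the opposite order. *)
Definition sofic_approximation (d : nat -> nat)
    (sigma : forall i, G -> 'S_(d i)) : Prop :=
  [/\ d @ \oo --> \oo,
      forall g h : G,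
        (fun i => #|[pred k | sigma i g (sigma i h k) == sigma i (g * h)%g k]|%:R
                  / (d i)%:R : R) @ \oo --> (1 : R) &
      forall g h : G, g <> h ->
        (fun i => #|[pred k | sigma i g k != sigma i h k]|%:R
                  / (d i)%:R : R) @ \oo --> (1 : R)].

(* Each [act g] has inverse [act g^-1], hence is a homeomorphism. *)
Definition acts_by_homeo (X : topologicalType) (act : G -> X -> X) : Prop :=
  [/\ forall x, act 1%g x = x,
      forall g h x, act (g * h)%g x = act g (act h x) &
      forall g, continuous (act g)].

Definition dynamically_generating (X : Type) (act : G -> X -> X)
    (rho : X -> X -> R) : Prop :=
  forall x y : X, x <> y -> exists g, 0 < rho (act g x) (act g y).

End Groups.

Arguments folner_sequence R {G} F.
Arguments amenable R G : clear implicits.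
Arguments sofic_approximation R {G} d sigma.

Definition eps_dense (R : realType) (T : Type) (d : T -> T -> R) (Y : set T)
    (e : R) (A : set T) : Prop :=
  A `<=` Y /\ forall y, Y y -> exists2 a, A a & d y a < e.

(* The infimum is attained when it is finite; it is +oo if no finite subset of
   [Y] is e-dense. *)
Definition covnum (R : realType) (T : Type) (d : T -> T -> R) (Y : set T)
    (e : R) : \bar R :=
  ereal_inf [set (n%:R)%:E | n in
    [set n : nat | exists A : set T, eps_dense d Y e A /\ (A #= `I_n)%card]].

Definition rho_l (R : realType) (X : Type) (rho : X -> X -> R) (p : R) (k : nat)
    (x y : 'I_k -> X) : R :=
  (k%:R^-1 * \sum_(j < k) rho (x j) (y j) `^ p) `^ p^-1.

Definition rho_F (R : realType) (G : groupType) (X : Type) (act : G -> X -> X)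
    (rho : X -> X -> R) (F : {fset G}) (p : R) (x y : X) : R :=
  (#|` F|%:R^-1 * \sum_(g <- F) rho (act g x) (act g y) `^ p) `^ p^-1.

Definition Map (R : realType) (G : groupType) (X : Type) (act : G -> X -> X)
    (rho : X -> X -> R) (F : {fset G}) (delta : R) (k : nat) (s : G -> 'S_k) :
    set ('I_k -> X) :=
  [set phi | forall g, g \in F ->
     rho_l rho 2 (fun j => phi (s g j)) (fun j => act g (phi j)) < delta].

Section MeanDimension.
Context {R : realType} {G : groupType} {X : Type}.
Variables (act : G -> X -> X) (rho : X -> X -> R) (p : R).
Local Open Scope ereal_scope.

(* [lne 0 = -oo], so an empty [Map] contributes [-oo]. *)
Definition mdim_sofic (d : nat -> nat) (sigma : forall i, G -> 'S_(d i)) :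
    \bar R :=
  limf_einf (fun e : R =>
    ereal_inf [set
      limn_esup (fun i : nat =>
        lne (covnum (@rho_l R X rho p (d i))
                    (Map act rho Fdelta.1 Fdelta.2 (sigma i)) e)
        / ((d i)%:R * ln (1 / e))%:E)
    | Fdelta in [set Fdelta : {fset G} * R | (0 < Fdelta.2)%R]])
  (0%R : R)^'+.

(* [v] is the common value of [mdim_sofic] over all sofic approximations. *)
Definition is_mdim (v : \bar R) : Prop :=
  (exists (d : nat -> nat) (sigma : forall i, G -> 'S_(d i)),
     sofic_approximation R d sigma) /\
  forall (d : nat -> nat) (sigma : forall i, G -> 'S_(d i)),
    sofic_approximation R d sigma -> mdim_sofic sigma = v.

Definition mdim_folner (F : nat -> {fset G}) : \bar R :=
  limf_einf (fun e : R =>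
    limn_esup (fun n : nat =>
      lne (covnum (rho_F act rho (F n) p) [set: X] e)
      / (#|` F n|%:R * ln (1 / e))%:E))
  (0%R : R)^'+.

End MeanDimension.

(* Main.v *)
Require Import Defs.
From HB Require Import structures.
From mathcomp Require Import all_boot all_order all_algebra all_fingroup.
From mathcomp Require Import finmap.
From mathcomp Require Import all_classical all_reals all_analysis.
From mathcomp Require Import ring lra zify.

Set Implicit Arguments.
Unset Strict Implicit.
Unset Printing Implicit Defensive.

Import Order.TTheory GRing.Theory Num.Theory.
Import numFieldNormedType.Exports.

Local Open Scope classical_set_scope.
Local Open Scope ring_scope.

(** The comparison is made at each scale separately. By a quasi-tiling argument
of Ornstein and Weiss, all but a small proportion of [{1, .., d_i}] is covered by
almost disjoint sets [sigma_i(F_n) c], with [n] ranging over a finite list of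
indices that may be taken in any prescribed infinite set; this is
[quasi_tiling], applied to Folner sets in [folner_tiling] and [sofic_tiling].

Upper bound. An element [phi] of [Map] satisfies
[phi (sigma_i(g) c) ~ g (phi c)] for most [g] and [c], so on a tile
[sigma_i(F_n) c] it follows the partial orbit of the point [phi c], and only the
position of [phi c] with respect to [rho_{F_n,p}] matters. Replacing each
[phi c] by a point of an [e]-dense subset of [(X, rho_{F_n,p})] encodes [phi] up
to an error [O(e)] for [rho_p], with at most [exp (v |F_n|)] choices per tile,
hence about [exp (v d_i)] choices in all ([covnum_Map_le], [sofic_upper]).

Lower bound. Conversely, any choice of a point in each tile gives an element of
[Map] that follows the corresponding orbits. If the points are taken in
[e]-separated sets of size [exp (u |F_n|)], two choices at [rho_p]-distance less
than [2 kappa e] may differ only on tiles of total proportion [O(kappa)]. So a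
ball of radius [kappa e] catches a proportion at most
[exp (- u (1 - O(kappa)) d_i)] of the choices ([covnum_Map_ge], [sofic_lower]).
Here the freedom in the choice of the indices [n] is essential: only
infinitely many of the [F_n] need to have large separated sets.

The constants [32] and [kappa] that rescale [e] disappear in the limit, because
[ln (1 / (C e)) / ln (1 / e)] tends to [1]. This gives
[mdim_sofic_le_folner] and [mdim_folner_le_sofic] for every sofic approximation
and every Folner sequence. A sofic approximation exists: translate inside the
Folner sets and complete these partial injections to permutations
([sofic_exists]). The value for a Folner sequence therefore does not depend on
the sequence, as all of them equal the value of this one sofic approximation.
When [X] is empty both sides are [-oo]. *)

(** * Quasi-tilings of a finite set by shapes in a group *)

Lemma leq_count_in (T : eqType) (a b : pred T) (r : seq T) :
  {in r, forall x, a x -> b x} -> (count a r <= count b r)%N.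
Proof.
elim: r => //= x r IH ab; apply: leq_add.
  by case ax : (a x); rewrite // ab// inE eqxx.
by apply: IH => y yr; apply: ab; rewrite inE yr orbT.
Qed.

Lemma leq_sum_mem (T : eqType) (r : seq T) (a : pred T) (f : T -> nat) x :
  x \in r -> a x -> (f x <= \sum_(y <- r | a y) f y)%N.
Proof. by move=> xr ax; rewrite (big_rem x)//= ax leq_addr. Qed.

Lemma sum1_cardr (R : realType) (T : finType) (A : pred T) :
  \sum_(x | A x) 1 = #|[set x | A x]%SET|%:R :> R.
Proof. by rewrite -sum1_card natr_sum; apply: eq_bigl => x; rewrite inE. Qed.

Lemma sum1_countr (R : realType) (T : Type) (A : pred T) (r : seq T) :
  \sum_(x <- r | A x) 1 = (count A r)%:R :> R.
Proof. by rewrite -sum1_count natr_sum. Qed.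

Lemma count_shift_le (G : groupType) (h : G) (Q : pred G) (A : {fset G}) :
  (count (fun g => ((h * g)%g \in A) && Q (h * g)%g) A <= count Q A)%N.
Proof.
rewrite -!size_filter -(size_map (fun g => (h * g)%g)); apply: uniq_leq_size.
  by rewrite map_inj_uniq ?filter_uniq ?fset_uniq//; exact: mulgI.
move=> x /mapP[g]; rewrite mem_filter => /andP[/andP[hgA Qhg] _] ->.
by rewrite mem_filter hgA Qhg.
Qed.

Section Tiling.
Context {R : realType} {G : groupType} {V J : finType}.
Variables (s : G -> V -> V) (S : J -> {fset G}).
Implicit Types (L : {fset G}) (C : {set V}) (P : {set J * V})
  (o : V -> option (J * V * G)).

(** The points at which the maps [s g], [g \in L], act like the translations of a
free action. *)
Definition good L : {set V} :=
  [set c | all (fun g => all (fun h =>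
     (s g (s h c) == s (g * h)%g c) && ((s g c == s h c) ==> (g == h))) L) L]%SET.

Lemma goodM L c g h : c \in good L -> g \in L -> h \in L ->
  s g (s h c) = s (g * h)%g c.
Proof.
by rewrite inE => /allP H gL hL; have /allP/(_ _ hL)/andP[/eqP] := H _ gL.
Qed.

Lemma good_inj L c g h : c \in good L -> g \in L -> h \in L ->
  s g c = s h c -> g = h.
Proof.
rewrite inE => /allP H gL hL /eqP e.
by have /allP/(_ _ hL)/andP[_ /implyP/(_ e)/eqP] := H _ gL.
Qed.

Definition owns o j c g := o (s g c) == Some (j, c, g).

Definition uncovered o : {set V} := [set w | ~~ o w]%SET.

(** A family of tiles, the tile [(j, c)] being [{s g c | g \in S j}], given by an
owner function: [o w = Some (j, c, g)] says that the tile [(j, c)] owns [w] and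
reaches it through [g]. A point has at most one owner, which replaces an explicit
disjointness condition, and the size condition allows the tiles to overlap in a
proportion [tau]. The last condition keeps track of the whole tile and not only
of the points that it owns; the boundary estimate in [tiling_stage] rests on it. *)
Record tiling (tau : R) C P o : Prop := Tiling {
  tiling_owner : forall w j c g, o w = Some (j, c, g) ->
    [/\ (j, c) \in P, g \in S j & w = s g c];
  tiling_center : forall j c, (j, c) \in P -> c \in C;
  tiling_size : forall j c, (j, c) \in P ->
    (1 - tau) * #|` S j|%:R <= (count (owns o j c) (S j))%:R;
  tiling_cover : forall j c g, (j, c) \in P -> g \in S j -> o (s g c) }.

(** Sums over covered points split into sums over tiles, since each covered point
is reached by exactly one owned pair of a tile and a group element. *)
Lemma tiling_sum tau C P o (f : V -> R) : tiling tau C P o ->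
  \sum_(w | o w) f w =
  \sum_(t in P) \sum_(g <- S t.1 | owns o t.1 t.2 g) f (s g t.2).
Proof.
move=> T.
transitivity (\sum_(w | o w) \sum_(t in P) \sum_(g <- S t.1 | o w == Some (t, g)) f w).
  apply: eq_bigr => w; case e: (o w) => [[[j c] g]|//] _.
  have [jcP gS _] := tiling_owner T e.
  rewrite (bigD1 (j, c))//= [X in _ = _ + X]big1 ?addr0; last first.
    move=> t /andP[_ tN]; rewrite big1// => h /eqP[h1 _].
    by rewrite -h1 eqxx in tN.
  rewrite big_mkcond (bigD1_seq g) ?fset_uniq// eqxx [in RHS]big1 /=; first by rewrite addr0.
  move=> h hg.
  by case: ifP => // /eqP[E]; rewrite E eqxx in hg.
rewrite exchange_big/=; apply: eq_bigr => -[j c] jcP /=.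
transitivity (\sum_(w | o w) \sum_(g <- S j) if o w == Some (j, c, g) then f w else 0).
  by apply: eq_bigr => w _; rewrite big_mkcond.
rewrite exchange_big/= [RHS]big_mkcond/=; apply: eq_bigr => g _.
rewrite /owns; case: ifP => [/eqP e|ne].
  rewrite (bigD1 (s g c)) ?e//= eqxx big1 ?addr0// => w /andP[_ wN].
  by case: ifP => // /eqP /(tiling_owner T)[_ _ E]; rewrite E eqxx in wN.
rewrite big1// => w _; case: ifP => // /eqP e'.
by have [_ _ E] := tiling_owner T e'; rewrite -E e' eqxx in ne.
Qed.

Lemma tiling_size_le tau C P o : tiling tau C P o ->
  (1 - tau) * \sum_(t in P) #|` S t.1|%:R <= #|V|%:R.
Proof.
move=> T; have E := tiling_sum (fun=> 1) T.
have : \sum_(w | o w) 1 <= #|V|%:R :> R by rewrite sum1_cardr ler_nat max_card.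
apply: le_trans; rewrite E mulr_sumr; apply: ler_sum => -[j c] jcP /=.
by rewrite sum1_countr; exact: tiling_size T _ _ jcP.
Qed.

(** A tile that meets the covered region in at most a proportion [tau] can be added:
it takes possession of its points that have no owner yet. *)
Lemma tiling_extend tau C P o k v : tiling tau C P o ->
  0 < tau <= 2^-1 -> (0 < #|` S k|)%N -> v \in C ->
  (forall c g h, c \in C -> g \in S k -> h \in S k -> s g c = s h c -> g = h) ->
  (count (fun g => o (s g v) : bool) (S k))%:R <= tau * #|` S k|%:R ->
  exists P' o', [/\ tiling tau C P' o', forall w, o w -> o' w,
    (#|uncovered o'| < #|uncovered o|)%N & P' = (k, v) |: P].
Proof.
move=> T /andP[tau0 tau1] Sk0 vC inj few.
pose o' w := if o w is Some x then Some x else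
  omap (fun g => (k, v, g)) (ohead [seq g <- S k | s g v == w]).
have oo' w : o w -> o' w by rewrite /o'; case: (o w).
have o'new g : g \in S k -> ~~ o (s g v) -> o' (s g v) = Some (k, v, g).
  move=> gS; rewrite /o'; case: (o (s g v)) => //= _.
  case E: [seq h <- S k | s h v == s g v] => [|h t] /=.
    have : g \in [seq h <- S k | s h v == s g v] by rewrite mem_filter eqxx.
    by rewrite E.
  have : h \in [seq h <- S k | s h v == s g v] by rewrite E inE eqxx.
  by rewrite mem_filter => /andP[/eqP e hS]; rewrite (inj _ _ _ vC hS gS e).
have cnt : (count (fun g => ~~ o (s g v)) (S k))%:R >= (1 - tau) * #|` S k|%:R.
  have /(congr1 (fun n => n%:R : R)) := count_predC (fun g => o (s g v) : bool) (S k).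
  rewrite natrD /=; set a := (count _ _)%:R in few *; set b := (count _ _)%:R.
  by move=> E; rewrite mulrBl mul1r -{1}E; move: few; lra.
exists ((k, v) |: P), o'; split => //; first split.
- move=> w j c g; rewrite /o'; case e: (o w) => [x|] /=.
    by case=> ex; subst x; have [? ? ?] := tiling_owner T e; split=> //; apply/setU1P; right.
  case E: [seq h <- S k | s h v == w] => [//|h t] /= [<- <- <-].
  have : h \in [seq h <- S k | s h v == w] by rewrite E inE eqxx.
  by rewrite mem_filter => /andP[/eqP<- hS]; split=> //; apply/setU1P; left.
- by move=> j c /setU1P[[_ ->]//|/(tiling_center T)].
- move=> j c; have [jcP _|jcP] := boolP ((j, c) \in P).
    apply: le_trans (tiling_size T jcP) _; rewrite ler_nat; apply: sub_count => g.
    by rewrite /owns /o' => /eqP ->.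
  case/setU1P => [[-> ->]|]; last by rewrite (negPf jcP).
  apply: le_trans cnt _; rewrite ler_nat.
  by apply: leq_count_in => g gS go; rewrite /owns o'new.
- move=> j c g /setU1P[[-> ->]|jcP] gS.
    by have [/oo'//|/(o'new _ gS)->] := boolP (o (s g v) : bool).
  exact: oo' (tiling_cover T jcP gS).
- apply: proper_card; apply/properP; split.
    by apply/fintype.subsetP => w; rewrite !inE; apply: contra => /oo'.
  have : has (fun g => ~~ o (s g v)) (S k).
    rewrite has_count -(ltr_nat R); apply: lt_le_trans cnt.
    by rewrite mulr_gt0 ?ltr0n//; lra.
  by case/hasP => g gS go; exists (s g v); rewrite inE ?go// o'new.
Qed.

(** Greedy choice: tiles of shape [k] are added as long as [tiling_extend] applies,
which stops because the number of uncovered points decreases. *)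
Lemma tiling_saturate tau C P o k : tiling tau C P o ->
  0 < tau <= 2^-1 -> (0 < #|` S k|)%N ->
  (forall c g h, c \in C -> g \in S k -> h \in S k -> s g c = s h c -> g = h) ->
  exists P' o', [/\ tiling tau C P' o', forall w, o w -> o' w,
    forall v, v \in C ->
      tau * #|` S k|%:R < (count (fun g => o' (s g v) : bool) (S k))%:R &
    forall j c, (j, c) \in P' -> (j, c) \in P \/ j = k].
Proof.
move=> T ht Sk0 inj; have [n] := ubnP #|uncovered o|.
elim: n P o T => // n IH P o T; rewrite ltnS => un.
have [/existsP[v /andP[vC few]]|] := boolP [exists v, (v \in C) &&
   ((count (fun g => o (s g v) : bool) (S k))%:R <= tau * #|` S k|%:R)].
  have [P1 [ o1 [T1 oo1 u1 EP]]] := tiling_extend T ht Sk0 vC inj few.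
  have [P2 [ o2 [T2 oo2 sat old]]] := IH P1 o1 T1 (leq_trans u1 un).
  exists P2, o2; split => //; first by move=> w /oo1 /oo2.
  move=> j c /old[]; last by right.
  by rewrite EP => /setU1P[[-> _]|]; [right|left].
rewrite negb_exists => /forallP many; exists P, o; split => // [v vC|j c]; last by left.
by have := many v; rewrite vC /= -ltNge.
Qed.

(** Tiles of one further shape cover a proportion [tau] of what remains, up to an
error. After saturation, each tile of shape [k] that avoids the old region, with
a good centre, has a proportion [tau] of its points in the new region; as the
maps [s g] are injective, double counting transfers this proportion to the
centres. The centres outside the old region whose tile meets it lie on the
boundary of old tiles, and there are few of them because the old shapes are
almost invariant under the elements of [S k]. *)
Lemma tiling_stage (tau gamma beta : R) C P o k : tiling tau C P o ->
  (forall g, injective (s g)) ->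
  0 < tau <= 2^-1 -> 0 <= beta -> (0 < #|` S k|)%N ->
  (forall c g h, c \in C -> g \in S k -> h \in S k -> s g c = s h c -> g = h) ->
  (forall j c g f, (j, c) \in P -> g \in S k -> f \in S j ->
     s g (s (g^-1 * f)%g c) = s f c) ->
  (forall j c, (j, c) \in P ->
     (\sum_(g <- S k) count (fun f => (g^-1 * f)%g \notin S j) (S j))%:R <=
       beta * #|` S j|%:R) ->
  #|~: C|%:R <= gamma * #|V|%:R ->
  exists P' o', [/\ tiling tau C P' o',
    #|uncovered o'|%:R - (gamma + 2 * beta) * #|V|%:R <=
     (1 - tau) * (#|uncovered o|%:R - (gamma + 2 * beta) * #|V|%:R) &
    forall j c, (j, c) \in P' -> (j, c) \in P \/ j = k].
Proof.
move=> T sinj ht beta0 Sk0 inj mult inv badC.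
have [P' [ o' [T' oo' sat old]]] := tiling_saturate T ht Sk0 inj.
exists P', o'; split => //.
(* Uncovered points are good centres with a tile outside the old region (W),
   boundary points (D), or bad points. *)
pose W := [set v in C | ~~ o v & all (fun g => ~~ o (s g v)) (S k)]%SET.
pose D := [set v | ~~ o v & has (fun g => o (s g v) : bool) (S k)]%SET.
have unW : (#|uncovered o| <= #|W| + #|D| + #|~: C|)%N.
  have sub : uncovered o \subset (W :|: D) :|: ~: C.
    apply/fintype.subsetP => v; rewrite !inE => ov; rewrite ov /=.
    case vC : (v \in C); rewrite ?orbT//= orbF.
    rewrite orbC -implyNb; apply/implyP; rewrite -all_predC; exact.
  apply: leq_trans (subset_leq_card sub) _.
  apply: leq_trans (leq_card_setU _ _) _; rewrite leq_add2r.
  exact: leq_card_setU.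
have DE : (#|D| <= \sum_(t in P) \sum_(g <- S k)
    count (fun f => (g^-1 * f)%g \notin S t.1) (S t.1))%N.
  pose F (t : J * V) g f v : nat := v == s (g^-1 * f)%g t.2.
  have D1 v : v \in D -> (1 <= \sum_(t in P) \sum_(g <- S k)
      \sum_(f <- S t.1 | (g^-1 * f)%g \notin S t.1) F t g f v)%N.
    rewrite inE => /andP[ov /hasP[g gS]]; case e : (o _) => [[[j c] f]|//] _.
    have [jcP fS E] := tiling_owner T e.
    (* v would be the point of the tile (j, c) reached through g^-1 * f, if
       g^-1 * f belonged to S j; as v is uncovered, it does not. *)
    have vE : v = s (g^-1 * f)%g c.
      by apply: (sinj g); rewrite (mult j)// E.
    have gfS : (g^-1 * f)%g \notin S j.
      by apply: contra ov => /(tiling_cover T jcP); rewrite -vE.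
    rewrite (bigD1 (j, c))//=; apply: leq_trans _ (leq_addr _ _).
    apply: leq_trans _ (@leq_sum_mem _ _ _ _ g gS isT) => //=.
    apply: leq_trans _ (@leq_sum_mem _ _ _ _ f fS gfS) => //=.
    by rewrite /F -vE eqxx.
  rewrite -sum1_card; apply: leq_trans; first by apply: leq_sum; exact: D1.
  rewrite exchange_big; apply: leq_sum => t _.
  rewrite exchange_big; apply: leq_sum => g _.
  rewrite exchange_big -sum1_count; apply: leq_sum => f _.
  rewrite /F -big_mkcondr /= sum1_card.
  apply: leq_trans (_ : #|pred1 (s (g^-1 * f)%g t.2)| <= 1)%N; last by rewrite card1.
  by apply: subset_leq_card; apply/fintype.subsetP => v; rewrite !inE => /andP[].
pose N := uncovered o :\: uncovered o'.
have NE : (#|N| + #|uncovered o'| = #|uncovered o|)%N.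
  have sub : uncovered o' \subset uncovered o.
    by apply/fintype.subsetP => w; rewrite !inE; apply: contra => /oo'.
  by rewrite -(cardsID (uncovered o') (uncovered o)) (finset.setIidPr sub) addnC.
have WN : (\sum_(v in W) count (fun g => o' (s g v) : bool) (S k) <= #|` S k| * #|N|)%N.
  apply: (@leq_trans (\sum_(v in W) \sum_(g <- S k) (s g v \in N))).
    apply: leq_sum => v; rewrite inE => /and3P[_ _ /allP vW].
    rewrite -sum1_count big_mkcond big_seq [leqRHS]big_seq; apply: leq_sum => g gS.
    by rewrite !inE vW// negbK andbT; case: (isSome _).
  rewrite exchange_big; apply: (@leq_trans (\sum_(g <- S k) #|N|)).
    apply: leq_sum => g _.
    rewrite -big_mkcondr sum1_card -(card_imset _ (sinj g)).
    apply/subset_leq_card/fintype.subsetP => w /imsetP[v].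
    by rewrite unfold_in => /andP[_ vN] ->.
  by rewrite big_const_seq count_predT iter_addn_0 mulnC.
have DR : #|D|%:R <= 2 * beta * #|V|%:R :> R.
  apply: (@le_trans _ _ (\sum_(t in P) beta * #|` S t.1|%:R)).
    apply: le_trans (_ : _ <= _%:R) _; first by rewrite ler_nat; exact: DE.
    by rewrite natr_sum; apply: ler_sum => -[j c]; exact: inv.
  rewrite -mulr_sumr; have := tiling_size_le T.
  set X := \sum_(t in P) _ => XV; rewrite (mulrC 2) -mulrA ler_wpM2l//.
  have : 0 <= X by apply: sumr_ge0.
  by move: ht XV => /andP[_ t2] XV X0; nra.
have {}WN : tau * #|W|%:R <= #|N|%:R.
  rewrite -(@ler_pM2l _ #|` S k|%:R) ?ltr0n// -[leRHS]natrM.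
  apply: le_trans (_ : _ <= _%:R) _; last by rewrite ler_nat; exact: WN.
  rewrite natr_sum mulrA mulr_natr mulrC -sumr_const; apply: ler_sum => v.
  by rewrite inE => /and3P[vC _ _]; exact/ltW/sat.
have {}unW : #|uncovered o|%:R <= #|W|%:R + #|D|%:R + #|~: C|%:R :> R.
  by rewrite -!natrD ler_nat.
have {}NE : #|N|%:R + #|uncovered o'|%:R = #|uncovered o|%:R :> R by rewrite -natrD NE.
move: ht => /andP[t0 _].
have := ler_wpM2l (ltW t0) unW; have := ler_wpM2l (ltW t0) DR.
have := ler_wpM2l (ltW t0) badC; move: WN NE; lra.
Qed.
End Tiling.

(** Each of the [l] stages multiplies the uncovered proportion by [1 - tau], up to
the error [gamma + 2 * beta]. The shapes are used in the order of their indices,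
so the first ones are the most invariant. *)
Lemma quasi_tiling (R : realType) (G : groupType) (V : finType) (l : nat)
    (s : G -> V -> V) (S : 'I_l -> {fset G}) (L : {fset G}) (tau beta gamma : R) :
  (forall g, injective (s g)) ->
  0 < tau <= 2^-1 -> 0 <= beta -> 0 <= gamma ->
  (forall k, (0 < #|` S k|)%N) ->
  (forall j k : 'I_l, (j < k)%N ->
     (\sum_(g <- S k) count (fun f => (g^-1 * f)%g \notin S j) (S j))%:R <=
       beta * #|` S j|%:R) ->
  (forall k g, g \in S k -> g \in L) ->
  (forall j k g f, g \in S k -> f \in S j -> (g^-1 * f)%g \in L) ->
  #|~: good s L|%:R <= gamma * #|V|%:R ->
  exists P o, tiling s S tau (good s L) P o /\
    #|uncovered o|%:R <= ((1 - tau) ^+ l + gamma + 2 * beta) * #|V|%:R.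
Proof.
move=> sinj ht beta0 gamma0 S0 inv SL SSL badC.
have /andP[t0 t1] := ht.
have: forall k : nat, (k <= l)%N -> exists P o, [/\ tiling s S tau (good s L) P o,
    #|uncovered o|%:R - (gamma + 2 * beta) * #|V|%:R <= (1 - tau) ^+ k * #|V|%:R &
    forall j c, (j, c) \in P -> (j < k)%N].
  elim=> [_|k IH kl].
    exists finset.set0, (fun=> None); split.
    - by split => // j c; rewrite inE.
    - have : (#|@uncovered G V 'I_l (fun=> None)|%:R <= #|V|%:R :> R) by rewrite ler_nat max_card.
      have : 0 <= (gamma + 2 * beta) * #|V|%:R by rewrite mulr_ge0//; lra.
      by rewrite expr0; lra.
    - by move=> j c; rewrite inE.
  have [P [ o [T un old]]] := IH (ltnW kl).
  have [ | | | P' [ o' [T' un' old']]] :=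
    tiling_stage (k := Ordinal kl) T sinj ht beta0 (S0 _) _ _ _ badC.
  - by move=> c g h cL gS hS; apply: good_inj cL _ _; apply: SL; eassumption.
  - move=> j c g f /(tiling_center T) cL gS fS.
    by rewrite (goodM cL) ?mulVKg//; [exact: SL gS|exact: SSL gS fS].
  - by move=> j c /old jk; exact: inv.
  exists P', o'; split => //; last first.
    by move=> j c /old'[/old/leqW//|->] /=.
  apply: le_trans un' _; rewrite exprS -mulrA ler_wpM2l//; lra.
move=> /(_ l (leqnn _))[P [ o [T un _]]]; exists P, o; split => //.
by move: un; lra.
Qed.

Lemma near_all_seq (T : eqType) (r : seq T) (P : T -> nat -> Prop) :
  (forall x, x \in r -> \forall n \near \oo, P x n) ->
  \forall n \near \oo, forall x, x \in r -> P x n.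
Proof.
elim: r => [_|x r IH H]; first by near=> n => x; rewrite in_nil.
have Hx := H x (mem_head _ _).
have Hr : \forall n \near \oo, forall y, y \in r -> P y n.
  by apply: IH => y yr; apply: H; rewrite inE yr orbT.
by near=> n => y; rewrite inE => /orP[/eqP->|]; [near: n|move: y; near: n].
Unshelve. all: by end_near. Qed.

Section Folner.
Context {R : realType} {G : groupType}.
Variable F : nat -> {fset G}.
Hypothesis F_folner : folner_sequence R F.

Lemma folner_gt0 n : (0 < #|` F n|)%N.
Proof. by case: F_folner => + _; move=> /(_ n); rewrite cardfs_gt0. Qed.

Lemma folner_shift (g : G) (beta : R) : 0 < beta ->
  \forall n \near \oo, (count (fun f => (g * f)%g \notin F n) (F n))%:R <= beta * #|` F n|%:R.
Proof.
move=> beta0; case: F_folner => _ /(_ g) /cvgrPdist_le /(_ _ beta0).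
apply: filterS => n; rewrite sub0r normrN ger0_norm ?divr_ge0//.
rewrite ler_pdivrMr ?ltr0n ?folner_gt0//; apply: le_trans; rewrite ler_nat.
rewrite -size_filter -(size_map (fun f => (g * f)%g)); apply: uniq_leq_size.
  by rewrite map_inj_uniq ?filter_uniq ?fset_uniq//; exact: mulgI.
move=> x /mapP[f]; rewrite mem_filter => /andP[gf fF] ->.
by rewrite !inE gf /=; apply/orP; left; apply/imfsetP; exists f.
Qed.

Lemma folner_shifts (K : {fset G}) (beta : R) : 0 < beta ->
  \forall n \near \oo, forall g, g \in K ->
    (count (fun f => (g * f)%g \notin F n) (F n))%:R <= beta * #|` F n|%:R.
Proof. by move=> beta0; apply: near_all_seq => g _; exact: folner_shift. Qed.

(** A set of fewer than [m] elements that is almost invariant under [m] translations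
would be exactly invariant under them, and would then contain a translate of the
set of these [m] elements. *)
Lemma folner_size : infinite_set [set: G] ->
  forall m : nat, \forall n \near \oo, (m <= #|` F n|)%N.
Proof.
move=> Ginf m; have [K _ Km] := infinite_set_fset m Ginf.
have m0 : 0 < (m.+1%:R)^-1 :> R by rewrite invr_gt0 ltr0n.
near=> n; rewrite leqNgt; apply/negP => Fm.
(* The defect is an integer less than 1. *)
have KF g : g \in K -> forall f, f \in F n -> (g * f)%g \in F n.
  move=> gK f fF; apply/negPn/negP => gf.
  have lt0 : (0 < count (fun f => (g * f)%g \notin F n) (F n))%N.
    by rewrite -has_count; apply/hasP; exists f.
  have : (count (fun f => (g * f)%g \notin F n) (F n))%:R <= (m.+1%:R)^-1 * #|` F n|%:R :> R.
    by move: g gK {gf lt0}; near: n; exact: folner_shifts.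
  rewrite mulrC ler_pdivlMr ?ltr0n// -natrM ler_nat.
  by move: lt0 Fm; set c := count _ _; nia.
have [f fF] : exists f, f \in F n by apply/fset0Pn; case: F_folner.
have : (#|` K| <= #|` F n|)%N.
  rewrite -(size_map (fun g => (g * f)%g)); apply: uniq_leq_size.
    by rewrite map_inj_uniq ?fset_uniq//; exact: mulIg.
  by move=> x /mapP[g gK ->]; exact: KF.
by move/(leq_trans Km); rewrite leqNgt Fm.
Unshelve. all: by end_near. Qed.
End Folner.

(** * Tiling sofic approximations by Folner sets *)

Definition frequently (Q : nat -> Prop) := forall m, exists n, (m <= n)%N /\ Q n.

Lemma frequently_near (Q E : nat -> Prop) :
  frequently Q -> (\forall n \near \oo, E n) -> frequently (fun n => Q n /\ E n).
Proof.
move=> Qf [N _ NE] m; have [n [le_n Qn]] := Qf (maxn m N).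
by exists n; move: le_n; rewrite geq_max => /andP[? ?]; do !split => //; apply: NE.
Qed.

Section Shapes.
Context {R : realType} {G : groupType}.
Variable F : nat -> {fset G}.
Hypothesis F_folner : folner_sequence R F.

Lemma folner_shiftV_sum (K : {fset G}) (beta : R) : 0 < beta ->
  \forall n \near \oo,
    (\sum_(g <- K) count (fun f => (g^-1 * f)%g \notin F n) (F n))%:R <= beta * #|` F n|%:R.
Proof.
move=> beta0; have b0 : 0 < beta / (#|` K|.+1)%:R by rewrite divr_gt0.
have := folner_shifts F_folner [fset g^-1%g | g in K]%fset b0.
apply: filterS => n H; rewrite natr_sum.
apply: (@le_trans _ _ (\sum_(g <- K) beta / (#|` K|.+1)%:R * #|` F n|%:R)).
  rewrite big_seq [leRHS]big_seq; apply: ler_sum => g gK.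
  by apply: H; apply/imfsetP; exists g.
rewrite big_const_seq count_predT iter_addr addr0 -[X in X <= _]mulr_natr.
rewrite mulrAC ler_wpM2r// mulrAC ler_pdivrMr// ler_wpM2l ?(ltW beta0)//.
by rewrite ler_nat.
Qed.

(** Indices are prepended one at a time, each so large that its Folner set is almost
invariant under all the Folner sets chosen before. *)
Lemma choose_shapes (Q : nat -> Prop) (l : nat) (beta : R) : 0 < beta ->
  frequently Q ->
  exists ns : seq nat, [/\ size ns = l, forall n, n \in ns -> Q n &
    pairwise (fun j k =>
      (\sum_(g <- F k) count (fun f => (g^-1 * f)%g \notin F j) (F j))%:R <=
        beta * #|` F j|%:R) ns].
Proof.
move=> beta0 Qf; elim: l => [|l [ns [ns_l nsQ ns_inv]]]; first by exists [::].
have : \forall n \near \oo, forall k, k \in ns ->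
    (\sum_(g <- F k) count (fun f => (g^-1 * f)%g \notin F n) (F n))%:R <=
        beta * #|` F n|%:R.
  by apply: near_all_seq => k _; exact: folner_shiftV_sum.
move=> /(frequently_near Qf)/(_ 0%N)[n [_ [Qn n_inv]]].
exists (n :: ns); split => [|k|] /=; first by rewrite ns_l.
  by rewrite inE => /orP[/eqP->|/nsQ].
by rewrite ns_inv andbT; apply/allP.
Qed.

(** The infinite set [Q] of admissible indices is what the lower bound needs, and the
finite set [L] is found before [V] and [s], so that the later maps of a sofic
approximation are almost everywhere good for it. *)
Lemma folner_tiling (Q : nat -> Prop) (K : {fset G}) (tau : R) :
  infinite_set [set: G] -> frequently Q -> 0 < tau <= 2^-1 ->
  exists (l : nat) (n : 'I_l -> nat) (L : {fset G}),
  [/\ forall j, [/\ Q (n j), tau^-1 <= #|` F (n j)|%:R &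
        forall g, g \in K -> (count (fun f => (g * f)%g \notin F (n j)) (F (n j)))%:R
                          <= tau * #|` F (n j)|%:R],
      forall g, g \in K -> g \in L,
      forall j g, g \in F (n j) -> g \in L &
      forall (V : finType) (s : G -> V -> V), (forall g, injective (s g)) ->
        #|~: good s L|%:R <= tau / 4 * #|V|%:R ->
        exists P o, tiling s (F \o n) tau (good s L) P o /\
          #|uncovered o|%:R <= tau * #|V|%:R].
Proof.
move=> Ginf Qf /[dup] ht /andP[t0 t1].
(* The remaining proportion is at most
   (1 - tau) ^+ l + tau / 4 + 2 * (tau / 8) <= tau. *)
have [l tl] : exists l : nat, (1 - tau) ^+ l <= tau / 2.
  have t12 : `|1 - tau| < 1 by rewrite ger0_norm; lra.
  have t20 : 0 < tau / 2 by rewrite divr_gt0.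
  have /cvgrPdist_le/(_ _ t20)[l _ /(_ l (leqnn l))] := cvg_expr t12.
  by rewrite /= sub0r normrN ger0_norm ?exprn_ge0//; [exists l|lra].
have [b0 b1] : 0 < tau / 8 /\ 0 <= tau / 4 by split; lra.
have [N Nt] : exists N : nat, tau^-1 <= N%:R.
  by exists (Num.trunc tau^-1).+1; exact/ltW/truncnS_gt.
have [ns [ns_l nsQ ns_inv]] := choose_shapes l b0 (frequently_near
  (frequently_near Qf (folner_shifts F_folner K t0)) (folner_size F_folner Ginf N)).
pose n (j : 'I_l) := nth 0%N ns j.
have n_ns j : n j \in ns by rewrite mem_nth// ns_l.
pose L1 := \big[fsetU/fset0]_(j : 'I_l) F (n j).
pose L2 := \big[fsetU/fset0]_(j : 'I_l) \big[fsetU/fset0]_(k : 'I_l)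
  [fset (g^-1 * f)%g | g in F (n k), f in F (n j)]%fset.
exists l, n, (K `|` (L1 `|` L2))%fset; split.
- move=> j; have [[Qn Kn] Nn] := nsQ _ (n_ns j).
  by split => //; apply: le_trans Nt _; rewrite ler_nat.
- by move=> g gK; rewrite !inE gK.
- move=> j g gF; rewrite !inE; apply/orP; right; apply/orP; left.
  by apply/bigfcupP; exists j; rewrite ?mem_index_enum.
- move=> V s sinj bad.
  have [ | | | | P [ o [T un]]] := @quasi_tiling R G V l s (F \o n)
    (K `|` (L1 `|` L2))%fset tau (tau / 8) (tau / 4) sinj ht (ltW b0) b1 _ _ _ _ bad.
  + by move=> j; exact: folner_gt0 F_folner _.
  + move=> j k jk; move: ns_inv => /(pairwiseP 0%N); apply => //; rewrite inE ns_l //.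
  + move=> j g gF; rewrite !inE; apply/orP; right; apply/orP; left.
    by apply/bigfcupP; exists j; rewrite ?mem_index_enum.
  + move=> j k g f gF fF; rewrite !inE; apply/orP; right; apply/orP; right.
    apply/bigfcupP; exists j; rewrite ?mem_index_enum//.
    apply/bigfcupP; exists k; rewrite ?mem_index_enum//.
    by apply/imfset2P; exists g => //; exists f.
  exists P, o; split => //; apply: le_trans un _.
  by rewrite ler_wpM2r//; move: tl; lra.
Qed.
End Shapes.

(** The bad points are covered by the exceptional sets of the [2 |L|^2] conditions
that define [good], each of which has vanishing proportion. *)
Lemma sofic_good (R : realType) (G : groupType) (d : nat -> nat)
    (sigma : forall i, G -> 'S_(d i)) (L : {fset G}) (gamma : R) :
  sofic_approximation R d sigma -> 0 < gamma ->
  \forall i \near \oo,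
    #|~: good (fun g v => sigma i g v) L|%:R <= gamma * (d i)%:R.
Proof.
move=> [d_oo sM s_ne] gamma0.
pose gamma1 := gamma / (2 * (#|` L|.+1)%:R ^+ 2).
have g10 : 0 < gamma1 by rewrite divr_gt0// mulr_gt0// exprn_gt0.
have d0 : \forall i \near \oo, (0 < d i)%N.
  by move: d_oo => /cvgnyPgt/(_ 0%N).
have fracC (A : forall i, pred 'I_(d i)) :
    (fun i => #|A i|%:R / (d i)%:R : R) @ \oo --> (1 : R) ->
    \forall i \near \oo, #|[predC A i]|%:R <= gamma1 * (d i)%:R.
  move=> /cvgrPdist_le/(_ _ g10) A1; near=> i.
  have di : (0 < d i)%N by near: i.
  have : `|1 - #|A i|%:R / (d i)%:R| <= gamma1 by near: i.
  have := cardC (A i); rewrite card_ord => /(congr1 (fun n => n%:R : R)).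
  rewrite natrD => E; rewrite ler_norml => /andP[_].
  rewrite lerBlDr -lerBlDl ler_pdivlMr ?ltr0n// mulrBl mul1r.
  have -> : #|predC (A i)|%:R = #|[predC A i]|%:R :> R by [].
  by move: E; lra.
have Mbad : \forall i \near \oo, forall g, g \in L -> forall h, h \in L ->
  #|[pred k | sigma i g (sigma i h k) != sigma i (g * h)%g k]|%:R <= gamma1 * (d i)%:R.
  apply: near_all_seq => g _; apply: near_all_seq => h _.
  exact: fracC (sM g h).
have Nbad : \forall i \near \oo, forall g, g \in L -> forall h, h \in L -> g != h ->
  #|[pred k | sigma i g k == sigma i h k]|%:R <= gamma1 * (d i)%:R.
  apply: near_all_seq => g _; apply: near_all_seq => h _.
  have [->|gh] := eqVneq g h; first by near=> i.
  have := fracC _ (s_ne g h (elimN eqP gh)); apply: filterS => i H _.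
  apply: le_trans H; rewrite ler_nat; apply: subset_leq_card.
  by apply/fintype.subsetP => k; rewrite !inE negbK.
near=> i.
have Mi : forall g, g \in L -> forall h, h \in L ->
  #|[pred k | sigma i g (sigma i h k) != sigma i (g * h)%g k]|%:R <= gamma1 * (d i)%:R.
  by near: i.
have Ni : forall g, g \in L -> forall h, h \in L -> g != h ->
  #|[pred k | sigma i g k == sigma i h k]|%:R <= gamma1 * (d i)%:R by near: i.
have : (#|~: good (fun g v => sigma i g v) L| <= \sum_(g <- L) \sum_(h <- L)
   (#|[pred k | sigma i g (sigma i h k) != sigma i (g * h)%g k]| +
    #|[pred k | (g != h) && (sigma i g k == sigma i h k)]|))%N.
  apply: (@leq_trans (\sum_(k : 'I_(d i)) \sum_(g <- L) \sum_(h <- L)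
     ((sigma i g (sigma i h k) != sigma i (g * h)%g k) +
     ((g != h) && (sigma i g k == sigma i h k))))).
    rewrite -sum1_card big_mkcond; apply: leq_sum => k _.
    case: ifP => //; rewrite !inE => /allPn[g gL /allPn[h hL]] bad.
    apply: leq_trans _ (@leq_sum_mem _ _ _ _ g gL isT) => //=.
    apply: leq_trans _ (@leq_sum_mem _ _ _ _ h hL isT) => //=.
    by move: bad; rewrite negb_and negb_imply andbC; do 2?case: (_ != _); case: (_ == _).
  rewrite exchange_big; apply: leq_sum => g _.
  rewrite exchange_big; apply: leq_sum => h _.
  by rewrite big_split/= -!sum1_card -!big_mkcond.
rewrite -(ler_nat R) => /le_trans; apply.
rewrite natr_sum big_seq.
apply: (@le_trans _ _ (\sum_(g <- L | g \in L) (#|` L|%:R * (2 * gamma1 * (d i)%:R)))).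
  apply: ler_sum => g gL; rewrite natr_sum big_seq.
  apply: (@le_trans _ _ (\sum_(h <- L | h \in L) (2 * gamma1 * (d i)%:R))).
    apply: ler_sum => h hL; rewrite natrD -mulrA mulr_natl mulr2n lerD ?Mi//.
    have [->|gh] := eqVneq g h; last exact: Ni.
    rewrite eq_card0 => [|k]; first by apply: mulr_ge0 => //; exact: ltW.
    by rewrite inE ?eqxx.
  by rewrite -big_seq big_const_seq count_predT iter_addr addr0 -[X in X <= _]mulr_natl.
rewrite -big_seq big_const_seq count_predT iter_addr addr0 -[X in X <= _]mulr_natl.
rewrite !mulrA ler_wpM2r// /gamma1; set m := #|` L|.
rewrite -[m.+1%:R]natr1 ler_pdivrMr ?mulr_gt0 ?exprn_gt0 ?ltr_wpDl//.
have m0 : 0 <= m%:R :> R by [].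
by have := mulr_ge0 (ltW gamma0) m0; have := ltW gamma0; move: (m%:R) => x; lra.
Unshelve. all: by end_near. Qed.

(** * Covering numbers, separated sets and power means *)

Section Covering.
Context {R : realType} {T : Type}.
Variables (d : T -> T -> R) (Y : set T) (e : R).

(** An [e]-dense subset given as the first [n] values of a sequence, which avoids
counting in a type that need not have decidable equality. *)
Definition net (n : nat) (f : nat -> T) : Prop :=
  (forall i, (i < n)%N -> Y (f i)) /\
  forall y, Y y -> exists2 i, (i < n)%N & d y (f i) < e.

Lemma covnum_le n f : net n f -> (covnum d Y e <= (n%:R)%:E)%E.
Proof.
move=> [fY fd]; pose A := f @` `I_n.
have An : (A #<= `I_n)%card by exact: card_image_le.
have [m Am] : finite_set A by apply/finite_set_leP; exists n.
apply: (@le_trans _ _ ((m%:R)%:E)).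
  apply: ereal_inf_lbound; exists m => //; exists A; split => //; split.
    by move=> _ [i /= ni <-]; exact: fY.
  by move=> y /fd[i ni yi]; exists (f i) => //; exists i.
by rewrite lee_fin ler_nat -card_le_II -(card_le_eql Am).
Qed.

Lemma dense_net (x0 : T) n A : eps_dense d Y e A -> (A #= `I_n)%card ->
  exists f, net n f.
Proof.
move=> [AY Ad] /card_set_bijP[g [gA ginj gsurj]].
have /choice[f fP] : forall i, exists a, (i < n)%N -> A a /\ g a = i.
  move=> i; have [ni|] := boolP (i < n)%N; last by exists x0.
  by have [a Aa <-] := gsurj i ni; exists a.
exists f; split => [i /fP[/AY]//|y /Ad[a Aa ya]].
have na : (g a < n)%N by exact: gA.
by exists (g a) => //; have [Af gf] := fP _ na;
  have -> : f (g a) = a by apply: ginj => //; exact: mem_set.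
Qed.

Lemma covnum_lt_net (x0 : T) (v : \bar R) : (covnum d Y e < v)%E ->
  exists n f, ((n%:R)%:E < v)%E /\ net n f.
Proof.
move=> /ereal_inf_lt[_ [n [A [Ad An]] <-] nv].
by have [f fn] := dense_net x0 Ad An; exists n, f.
Qed.

Lemma covnum_ge (x0 : T) (c : R) : (forall n f, net n f -> c <= n%:R) ->
  (c%:E <= covnum d Y e)%E.
Proof.
move=> H; apply: le_ereal_inf_tmp => _ [n [A [Ad An]] <-].
by have [f fn] := dense_net x0 Ad An; rewrite lee_fin; exact: H fn.
Qed.

(** One representative per code of [Y] gives an [e]-dense set. *)
Lemma covnum_le_codes (I : finType) (B : {set I}) (c : T -> I) (x0 : T) :
  (forall y, Y y -> c y \in B) ->
  (forall y z, Y y -> Y z -> c y = c z -> d y z < e) ->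
  (covnum d Y e <= (#|B|%:R)%:E)%E.
Proof.
move=> cB cd; pose B' := [set b in B | `[< exists2 y, Y y & c y = b >]]%SET.
apply: (@le_trans _ _ (#|B'|%:R)%:E); last first.
  by rewrite lee_fin ler_nat subset_leq_card//; apply/fintype.subsetP => b; rewrite inE => /andP[].
have /choice[f fP] : forall i, exists y, forall b,
    b \in B' -> index b (enum B') = i -> Y y /\ c y = b.
  move=> i; have [ib|ib] := boolP (i < #|B'|)%N; last first.
    exists x0 => b bB ibE; move: ib.
    by rewrite -ibE cardE index_mem mem_enum bB.
  pose b := enum_val (Ordinal ib).
  have := enum_valP (Ordinal ib); rewrite -/b inE => /andP[_ /asboolP[y Yy yb]].
  exists y => b' b'B ib'; split => //; rewrite yb /b (enum_val_nth b') /= -ib'.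
  by rewrite nth_index// mem_enum.
apply: (@covnum_le _ f); split.
  move=> i ib; have := enum_valP (Ordinal ib); set b := enum_val _ => bB.
  have [] := fP i b bB => //.
  rewrite /b (enum_val_nth b) /= index_uniq ?enum_uniq// -cardE//.
move=> y Yy; have cyB : c y \in B' by rewrite inE cB//=; apply/asboolP; exists y.
exists (index (c y) (enum B')); first by rewrite cardE index_mem mem_enum.
by have [? ?] := fP _ _ cyB erefl; apply: cd.
Qed.

(** An [e]-dense set of [n] points covers the points [Phi b] by [n] balls, and each of
these balls contains at most [m] of them. *)
Lemma covnum_ge_packing (I : finType) (B : {set I}) (Phi : I -> T) (x0 : T)
    (near : rel I) (m : R) :
  0 < m ->
  (forall b, b \in B -> Y (Phi b)) ->
  (forall b, b \in B -> #|[set b' in B | near b b']%SET|%:R <= m) ->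
  (forall b b' y, b \in B -> b' \in B -> d (Phi b) y < e -> d (Phi b') y < e ->
     near b b') ->
  ((#|B|%:R / m)%:E <= covnum d Y e)%E.
Proof.
move=> m0 BY nearm dnear; apply: (covnum_ge x0) => n f [_ fd].
rewrite ler_pdivrMr//.
pose Bi (i : 'I_n) := [set b in B | d (Phi b) (f i) < e]%SET.
have sub : B \subset (\bigcup_i Bi i)%SET.
  apply/fintype.subsetP => b bB; have [i ni bi] := fd _ (BY _ bB).
  by apply/finset.bigcupP; exists (Ordinal ni); rewrite // inE bB.
have Bim i : #|Bi i|%:R <= m.
  have [->|[b]] := finset.set_0Vmem (Bi i); first by rewrite cards0 ltW.
  rewrite inE => /andP[bB bi]; apply: le_trans (nearm b bB); rewrite ler_nat.
  apply/subset_leq_card/fintype.subsetP => b'; rewrite !inE => /andP[b'B b'i].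
  by rewrite b'B /=; exact: dnear bi b'i.
apply: (@le_trans _ _ (\sum_(i < n) #|Bi i|%:R)).
  rewrite -natr_sum ler_nat; apply: leq_trans (subset_leq_card sub) _.
  by apply: (big_rec2 (fun (A : {set I}) k => (#|A| <= k)%N)) => [|i k A _ Ak];
    rewrite ?cards0//; apply: leq_trans (leq_card_setU _ _) _; rewrite leq_add2l.
apply: le_trans (ler_sum _ (fun i _ => Bim i)) _.
by rewrite sumr_const card_ord mulr_natl.
Qed.

End Covering.

(** A separated family with fewer points than any [e]-dense set is not dense, so it
can be extended. *)
Lemma separated_of_covnum (R : realType) (T : Type) (d : T -> T -> R) (e : R)
    (x0 : T) (q : nat) :
  0 < e -> (forall x, d x x = 0) -> (forall x y, d x y = d y x) ->
  ((q%:R)%:E <= covnum d [set: T] e)%E ->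
  exists f : nat -> T, forall i j, (i < q)%N -> (j < q)%N -> i <> j -> e <= d (f i) (f j).
Proof.
move=> e0 d0 dC; elim: q => [_|q IH cq]; first by exists (fun=> x0).
have [f fP] : exists f : nat -> T, forall i j,
    (i < q)%N -> (j < q)%N -> i <> j -> e <= d (f i) (f j).
  by apply: IH; apply: le_trans cq; rewrite lee_fin ler_nat.
have [y yP] : exists y, forall i, (i < q)%N -> e <= d y (f i).
  apply: contrapT => /forallNP H.
  have /covnum_le : net d setT e q f.
    split => // y _; apply: contrapT => /forall2NP H'; apply: (H y) => i iq.
    by have [//|/negP] := H' i; rewrite -leNgt.
  by move=> /(le_trans cq); rewrite lee_fin ler_nat ltnn.
exists (fun i => if (i < q)%N then f i else y) => i j iq jq ij.
have [i1|i1] := ltnP i q; have [j1|j1] := ltnP j q.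
- exact: fP.
- by rewrite dC yP.
- by rewrite yP.
- by exfalso; apply: ij; lia.
Qed.

Section PowerMeans.
Context {R : realType}.
Implicit Types (p a b e : R).

(** A substitute for Minkowski's inequality: the loss of constant factors is
harmless, because scales are only compared up to such factors. *)
Lemma powRD_le p a b : 0 <= p -> 0 <= a -> 0 <= b ->
  (a + b) `^ p <= 2 `^ p * (a `^ p + b `^ p).
Proof.
move=> p0 a0 b0; have [ab|ab] := leP a b.
  apply: (@le_trans _ _ ((2 * b) `^ p)).
    by apply: ge0_ler_powR; rewrite ?nnegrE ?addr_ge0 ?mulr_ge0//; lra.
  by rewrite powRM// ler_wpM2l ?powR_ge0// lerDr powR_ge0.
apply: (@le_trans _ _ ((2 * a) `^ p)).
  by apply: ge0_ler_powR; rewrite ?nnegrE ?addr_ge0 ?mulr_ge0//; lra.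
by rewrite powRM// ler_wpM2l ?powR_ge0// lerDl powR_ge0.
Qed.

Lemma power_mean_lt p e A (n : nat) : 0 < p -> 0 < e -> 0 <= A -> (0 < n)%N ->
  ((n%:R^-1 * A) `^ p^-1 < e) = (A < n%:R * e `^ p).
Proof.
move=> p0 e0 A0 n0; have p10 : 0 < p^-1 by rewrite invr_gt0.
have nA : 0 <= n%:R^-1 * A by rewrite mulr_ge0.
have eE : (e `^ p) `^ p^-1 = e by rewrite -powRrM divff ?gt_eqF// powRr1 ?ltW.
have AE : ((n%:R^-1 * A) `^ p^-1) `^ p = n%:R^-1 * A.
  by rewrite -powRrM mulVf ?gt_eqF// powRr1.
rewrite -[in RHS]ltr_pdivrMl ?ltr0n//; apply/idP/idP => H.
  by rewrite -AE; apply: gt0_ltr_powR; rewrite ?nnegrE ?powR_ge0 // ltW.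
by rewrite -eE; apply: gt0_ltr_powR; rewrite ?nnegrE ?powR_ge0.
Qed.

(** On a bounded range a small quadratic mean forces a small mean of order [p]; this
is how the quadratic condition in [Map] controls [rho_p]. *)
Lemma powR_le_square p D eta : 0 < p -> 0 <= D -> 0 < eta ->
  exists2 C, 0 <= C & forall t, 0 <= t -> t <= D -> t `^ p <= eta + C * t ^+ 2.
Proof.
move=> p0 D0 eta0; pose t0 := eta `^ p^-1.
have t00 : 0 < t0 by exact: powR_gt0.
exists (D `^ p / t0 ^+ 2); first by rewrite divr_ge0 ?powR_ge0 ?exprn_ge0 ?ltW.
move=> t t_ge0 tD; have [tt0|tt0] := leP t t0.
  apply: (@le_trans _ _ eta).
    have -> : eta = t0 `^ p by rewrite /t0 -powRrM mulVf ?gt_eqF// powRr1 ?ltW.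
    by apply: ge0_ler_powR; rewrite ?nnegrE// ltW.
  by rewrite lerDl mulr_ge0 ?exprn_ge0// divr_ge0 ?powR_ge0 ?exprn_ge0 ?ltW.
apply: (@le_trans _ _ (D `^ p)); first by apply: ge0_ler_powR; rewrite ?nnegrE// ltW.
apply: (@le_trans _ _ (D `^ p / t0 ^+ 2 * t ^+ 2)); last by rewrite lerDr ltW.
rewrite mulrAC ler_pdivlMr ?exprn_gt0// ler_wpM2l ?powR_ge0//.
by rewrite ler_sqr ?nnegrE // ltW.
Qed.

End PowerMeans.

(** * Covering numbers of Map at a fixed stage *)

Section Codes.
Context {I : finType} {M : nat}.
Implicit Types (P : {set I}) (q : I -> nat).

(** Functions choosing one of [q t] values at each [t \in P]; the value outside [P] is
fixed, so that distinct codes differ somewhere on [P]. *)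
Definition codes P q : {set {ffun I -> 'I_M.+1}} :=
  [set b : {ffun I -> 'I_M.+1} | [forall t, if t \in P then (b t < q t)%N else b t == ord0]]%SET.

Lemma codesP P q (b : {ffun I -> 'I_M.+1}) :
  reflect ((forall t, t \in P -> (b t < q t)%N) /\
           (forall t, t \notin P -> b t = ord0)) (b \in codes P q).
Proof.
rewrite inE; apply: (iffP forallP) => [H|[H1 H2] t].
  by split => t tP; have := H t; [rewrite tP|rewrite (negPf tP) => /eqP].
by case: ifP => [/H1//|/negbT/H2 ->].
Qed.

Lemma card_codes P q : (forall t, (q t <= M.+1)%N) ->
  #|codes P q| = (\prod_(t in P) q t)%N.
Proof.
move=> qM.
pose E t : pred 'I_M.+1 := fun i => if t \in P then (i < q t)%N else i == ord0.
have -> : #|codes P q| = #|(family E : simpl_pred {ffun I -> 'I_M.+1})|.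
  by apply: eq_card => b; rewrite inE.
rewrite card_family foldrE big_map [RHS]big_mkcond -big_enum/=.
apply: eq_bigr => t _; case: ifP => tP; last first.
  by rewrite -[RHS](card1 (ord0 : 'I_M.+1)); apply: eq_card => i; rewrite /in_mem/= /E tP.
have -> : #|E t| = #|[set widen_ord (qM t) i | i in 'I_(q t)]%SET|.
  apply: eq_card => i; rewrite /in_mem/= /E tP.
  apply/idP/imsetP => [iq|[j _ ->]]; last exact: ltn_ord j.
  by exists (Ordinal iq) => //; exact: val_inj.
by rewrite card_imset ?card_ord// => i j /(congr1 val)/= ij; exact: val_inj.
Qed.
End Codes.

Section Bounds.
Context {R : realType} {G : groupType} {X : Type}.
Variables (act : G -> X -> X) (rho : X -> X -> R) (p D : R).
Hypothesis rho_pm : is_pseudometric rho.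
Hypothesis rhoD : forall x y, rho x y <= D.
Hypothesis p1 : 1 <= p.

Let p0 : 0 < p. Proof. by apply: lt_le_trans p1. Qed.
Let rho0 x y : 0 <= rho x y. Proof. by case: rho_pm. Qed.
Let rhoC x y : rho x y = rho y x. Proof. by case: rho_pm. Qed.
Let rhoT x y z : rho x z <= rho x y + rho y z. Proof. by case: rho_pm. Qed.

Lemma rho_l_lt (k : nat) (x y : 'I_k -> X) (e : R) : 0 < e -> (0 < k)%N ->
  (rho_l rho p x y < e) = (\sum_(j < k) rho (x j) (y j) `^ p < k%:R * e `^ p).
Proof.
by move=> e0 k0; apply: power_mean_lt => //; apply: sumr_ge0 => *; exact: powR_ge0.
Qed.

Lemma rho_F_lt (S : {fset G}) x y (e : R) : 0 < e -> (0 < #|` S|)%N ->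
  (rho_F act rho S p x y < e) =
  (\sum_(g <- S) rho (act g x) (act g y) `^ p < #|` S|%:R * e `^ p).
Proof.
by move=> e0 k0; apply: power_mean_lt => //; apply: sumr_ge0 => *; exact: powR_ge0.
Qed.

Lemma rho_powR_triangle x y z :
  rho x z `^ p <= 2 `^ p * (rho x y `^ p + rho y z `^ p).
Proof.
apply: le_trans (powRD_le (ltW p0) (rho0 _ _) (rho0 _ _)).
by apply: ge0_ler_powR; rewrite ?nnegrE ?addr_ge0 ?(ltW p0).
Qed.

Lemma rho_powR_chain a b c d f : rho a f `^ p <=
  4 `^ p * (rho a b `^ p + rho b c `^ p + rho c d `^ p + rho d f `^ p).
Proof.
have -> : 4 = 2 * 2 :> R by rewrite -natrM.
rewrite powRM// -mulrA; apply: le_trans (rho_powR_triangle a c f) _.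
rewrite ler_wpM2l ?powR_ge0// -addrA mulrDr.
by apply: lerD; exact: rho_powR_triangle.
Qed.

Section Upper.
Context {k : nat} {J : finType} (s : G -> 'S_k) (S : J -> {fset G}).
Let V : finType := 'I_k.
Let sv (g : G) (v : V) : V := s g v.

(** The code of [phi] records, for each tile [(j, c)], a point [f j i] of the net
that is close to [phi c]. If [phi] and [psi] have the same code, then at an owned
point [s g c] they are compared along the chain
[phi (s g c)], [g (phi c)], [g (f j i)], [g (psi c)], [psi (s g c)]. *)
Lemma covnum_Map_le (tau delta e : R) (K : {fset G}) (C : {set V})
    (P : {set J * V}) (o : V -> option (J * V * G))
    (N : J -> nat) (f : J -> nat -> X) (x0 : X) :
  (0 < k)%N -> 0 < e -> tau <= 2^-1 ->
  (forall j, (0 < #|` S j|)%N) ->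
  tiling sv S tau C P o ->
  (forall j, net (rho_F act rho (S j) p) setT e (N j) (f j)) ->
  #|uncovered o|%:R * D `^ p <= k%:R * e `^ p ->
  (forall phi, Map act rho K delta s phi ->
     \sum_(j : J) \sum_(g <- S j) \sum_(c : V) rho (phi (s g c)) (act g (phi c)) `^ p
       <= k%:R * e `^ p) ->
  (covnum (@rho_l R X rho p k) (Map act rho K delta s) (32 * e) <=
     ((\prod_(t in P) N t.1)%N%:R)%:E)%E.
Proof.
move=> k0 e0 tau2 S0 T fnet unc Mapk.
pose M := (\max_(j : J) N j)%N.
have NM (t : J * V) : (N t.1 <= M.+1)%N by rewrite ltnW// ltnS; exact: leq_bigmax.
have /choice[c1 c1P] : forall t : (('I_k -> X) * (J * V)), exists i : 'I_M.+1,
    (i < N t.2.1)%N /\ rho_F act rho (S t.2.1) p (t.1 t.2.2) (f t.2.1 i) < e.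
  move=> [phi [j c]] /=; have [_ /(_ (phi c) I)[i iN ie]] := fnet j.
  have iM : (i < M.+1)%N := leq_trans iN (NM (j, c)).
  by exists (Ordinal iM).
pose code phi : {ffun J * V -> 'I_M.+1} :=
  [ffun t => if t \in P then c1 (phi, t) else ord0].
rewrite -(@card_codes _ M P (fun t => N t.1) NM).
apply: (@covnum_le_codes _ _ _ _ _ _ _ code (fun=> x0)).
  move=> phi _; apply/codesP; split => t tP; rewrite ffunE.
    by rewrite tP; have [] := c1P (phi, t).
  by rewrite (negPf tP).
move=> phi psi Mphi Mpsi codeE; rewrite rho_l_lt// ?mulr_gt0//.
have eP t : t \in P -> c1 (phi, t) = c1 (psi, t).
  by move=> tP; have /ffunP/(_ t) := codeE; rewrite !ffunE tP.
set E := k%:R * e `^ p in unc Mapk.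
have E0 : 0 < E by rewrite mulr_gt0 ?ltr0n ?powR_gt0.
have un_le : \sum_(v | ~~ o v) rho (phi v) (psi v) `^ p <= E.
  apply: le_trans unc; rewrite /uncovered mulrC -sum1_cardr mulr_sumr.
  apply: ler_sum => v _; rewrite mulr1; apply: ge0_ler_powR; rewrite ?nnegrE ?(ltW p0)//.
  exact: le_trans (rho0 _ _) (rhoD (phi v) (psi v)).
have orbit_le chi : Map act rho K delta s chi ->
    \sum_(t in P) \sum_(g <- S t.1) rho (chi (s g t.2)) (act g (chi t.2)) `^ p <= E.
  move=> /Mapk; apply: le_trans.
  apply: (@le_trans _ _ (\sum_(t : J * V) \sum_(g <- S t.1)
    rho (chi (s g t.2)) (act g (chi t.2)) `^ p)).
    rewrite [leLHS]big_mkcond; apply: ler_sum => t _; case: ifP => // _.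
    by apply: sumr_ge0 => *; exact: powR_ge0.
  rewrite -(pair_big xpredT xpredT (fun j c => \sum_(g <- S j)
    rho (chi (s g c)) (act g (chi c)) `^ p))/=.
  by apply: ler_sum => j _; rewrite exchange_big.
have net_le chi : (forall t, t \in P -> c1 (chi, t) = c1 (phi, t)) ->
    \sum_(t in P) \sum_(g <- S t.1)
      rho (act g (chi t.2)) (act g (f t.1 (c1 (phi, t)))) `^ p <= 2 * E.
  move=> chiE; apply: (@le_trans _ _ (\sum_(t in P) #|` S t.1|%:R * e `^ p)).
    apply: ler_sum => t tP; have [_] := c1P (chi, t).
    by rewrite rho_F_lt// chiE// => /ltW.
  rewrite -mulr_suml mulrA ler_wpM2r ?powR_ge0//.
  have := tiling_size_le T; rewrite card_ord.
  have : 0 <= \sum_(t in P) #|` S t.1|%:R :> R by apply: sumr_ge0.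
  by set Y := \sum_(t in P) _; move: tau2; nra.
rewrite (bigID (fun v => o v : bool))/= (tiling_sum _ T).
apply: (@le_lt_trans _ _ (4 `^ p * (E + 2 * E + 2 * E + E) + E)).
  apply: lerD un_le; apply: le_trans
    (ler_wpM2l (powR_ge0 _ _)
      (lerD (lerD (lerD (orbit_le _ Mphi) (net_le phi _)) (net_le psi _)) (orbit_le _ Mpsi))) => //; last first.
    by move=> t tP; rewrite eP.
  rewrite -!big_split mulr_sumr; apply: ler_sum => t tP /=.
  rewrite big_mkcond -!big_split mulr_sumr; apply: ler_sum => g _ /=.
  have := rho_powR_chain (phi (s g t.2)) (act g (phi t.2))
     (act g (f t.1 (c1 (phi, t)))) (act g (psi t.2)) (psi (s g t.2)).
  rewrite (rhoC (act g (f _ _))) (rhoC (act g (psi _)) (psi _)) => /(le_trans _); apply.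
  by case: ifP => // _; exact: powR_ge0.
have -> : 32 * e = 4 * (8 * e) by rewrite mulrA -natrM.
rewrite !powRM ?mulr_ge0 ?ltW//.
have p4 : 1 <= 4 `^ p :> R.
  by rewrite -[X in X <= _](powRr0 4); apply: ler_powR; [rewrite ler1n|exact: ltW].
have p8 : 8 <= 8 `^ p :> R by apply: le1r_powR; rewrite ?ler1n.
rewrite (_ : k%:R * _ = 4 `^ p * (8 `^ p * E)); last by rewrite /E; ring.
have : 8 * E <= 8 `^ p * E by rewrite ler_wpM2r// ltW.
move: p4; set a := 4 `^ p; set b := 8 `^ p * E => a1 Eb.
have := ler_wpM2l (le_trans ler01 a1) Eb; have := ler_wpM2r (ltW E0) a1; nra.
Qed.
End Upper.

Section Lower.
Context {k : nat} {J : finType} (s : G -> 'S_k) (S : J -> {fset G}).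
Hypothesis actM : forall g h x, act (g * h)%g x = act g (act h x).
Let V : finType := 'I_k.
Let sv (g : G) (v : V) : V := s g v.

Section Model.
Variables (tau u e : R) (L : {fset G}) (P : {set J * V})
  (o : V -> option (J * V * G)) (q : J -> nat) (f : J -> nat -> X) (x0 : X)
  (M : nat).
Hypothesis (T : tiling sv S tau (good sv L) P o).
Hypothesis (tau0 : 0 < tau) (tau2 : tau <= 2^-1).
Hypothesis (S0 : forall j, (0 < #|` S j|)%N).
Hypothesis (unc : #|uncovered o|%:R <= tau * k%:R).
Implicit Types b : {ffun J * V -> 'I_M.+1}.

(** The map that follows on each tile the orbit of the point chosen by the code. *)
Definition orbit_model b (v : V) : X :=
  if o v is Some (j, c, g) then act g (f j (b (j, c))) else x0.

Let mass := \sum_(t in P) #|` S t.1|%:R : R.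

Lemma mass_le : mass <= 2 * k%:R.
Proof.
have := tiling_size_le T; rewrite card_ord -/mass.
have : 0 <= mass by apply: sumr_ge0.
by move: tau2; nra.
Qed.

Lemma mass_ge : (1 - tau) * k%:R <= mass.
Proof.
have : \sum_(v | o v) 1 <= mass.
  rewrite (tiling_sum (fun=> 1) T); apply: ler_sum => t _.
  by rewrite sum1_countr ler_nat count_size.
have : \sum_(v | o v) 1 + \sum_(v | ~~ o v) 1 = k%:R :> R.
  by rewrite -(bigID (fun v => o v : bool) xpredT)/= sumr_const card_ord.
by rewrite (sum1_cardr _ (fun v => ~~ o v)) -/(uncovered o); move: unc; lra.
Qed.

Lemma not_owned_le j c : (j, c) \in P ->
  (count (fun g => ~~ owns sv o j c g) (S j))%:R <= tau * #|` S j|%:R.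
Proof.
move=> jcP; have := tiling_size T jcP.
have /(congr1 (fun n => n%:R : R)) := count_predC (owns sv o j c) (S j).
by rewrite natrD mulrBl mul1r => <-; rewrite /predC/=; lra.
Qed.

Lemma orbit_model_owned b j c g : owns sv o j c g ->
  orbit_model b (sv g c) = act g (f j (b (j, c))).
Proof. by move=> /eqP; rewrite /orbit_model => ->. Qed.

(** Equivariance under [h] can fail only at uncovered points, at points whose
translate by [h] leaves the tile, or at points whose translate by [h] is owned by
another tile. Each kind has proportion [O(tau)]. *)
Lemma orbit_model_Map b (K : {fset G}) (delta : R) :
  (0 < k)%N -> 0 < delta -> 5 * tau * D `^ 2 < delta `^ 2 ->
  (forall g, g \in K -> g \in L) -> (forall j g, g \in S j -> g \in L) ->
  (forall j g, g \in K ->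
     (count (fun h => (g * h)%g \notin S j) (S j))%:R <= tau * #|` S j|%:R) ->
  Map act rho K delta s (orbit_model b).
Proof.
move=> k0 delta0 tauD KL SL inv h hK.
rewrite /rho_l power_mean_lt//; last by apply: sumr_ge0 => *; exact: powR_ge0.
set psi := fun v => rho (orbit_model b (s h v)) (act h (orbit_model b v)) `^ 2.
rewrite -[X in X < _]/(\sum_(v : V) psi v).
have D2 v : psi v <= D `^ 2.
  apply: ge0_ler_powR; rewrite ?nnegrE//.
  exact: le_trans (rho0 _ _) (rhoD (orbit_model b v) (orbit_model b v)).
have D20 : 0 <= D `^ 2 by exact: powR_ge0.
have unc_le : \sum_(v | ~~ o v) psi v <= D `^ 2 * (tau * k%:R).
  apply: le_trans (ler_wpM2l D20 unc); rewrite /uncovered -sum1_cardr mulr_sumr.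
  by apply: ler_sum => v _; rewrite mulr1.
rewrite (bigID (fun v => o v : bool))/= (tiling_sum _ T).
have own_le t : t \in P -> \sum_(g <- S t.1 | owns sv o t.1 t.2 g) psi (sv g t.2) <=
    D `^ 2 * (2 * tau * #|` S t.1|%:R).
  case: t => j c jcP /=.
  apply: (@le_trans _ _ (D `^ 2 * ((count (fun g => (h * g)%g \notin S j) (S j))%:R +
    (count (fun g => ((h * g)%g \in S j) && ~~ owns sv o j c (h * g)%g) (S j))%:R))); last first.
    rewrite ler_wpM2l// -mulrA mulr_natl mulr2n; apply: lerD; first exact: inv.
    by apply: le_trans (not_owned_le jcP); rewrite ler_nat; exact: count_shift_le.
  rewrite mulrDr -!sum1_countr !mulr_sumr.
  rewrite [X in _ <= X + _]big_mkcond [X in _ <= _ + X]big_mkcond -big_split/=.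
  rewrite big_mkcond big_seq [leRHS]big_seq; apply: ler_sum => g gS.
  rewrite mulr1; case: ifP => [ow|_]; last first.
    by apply: addr_ge0; case: ifP.
  have [hgS|hgS] /= := boolP ((h * g)%g \in S j); last by rewrite addr0.
  rewrite add0r; case: ifPn => // /negbNE ohg.
  rewrite /psi; have := goodM (tiling_center T jcP) (KL _ hK) (SL _ _ gS).
  rewrite /sv => ->; rewrite (orbit_model_owned b ohg) (orbit_model_owned b ow).
  by rewrite actM (let: And4 _ r _ _ := rho_pm in r) powR0.
apply: le_lt_trans (lerD (ler_sum _ own_le) unc_le) _.
rewrite -mulr_sumr -mulr_sumr -/mass.
have := ler_wpM2l (mulr_ge0 D20 (mulr_ge0 (ler0n _ 2) (ltW tau0))) mass_le.
have : 5 * tau * D `^ 2 * k%:R < delta `^ 2 * k%:R by rewrite ltr_pM2r ?ltr0n.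
move: (D `^ 2) (delta `^ 2) (k%:R) mass => a d x m; lra.
Qed.

Definition separated_nets := forall j i i', (i < q j)%N -> (i' < q j)%N -> i <> i' ->
  e <= rho_F act rho (S j) p (f j i) (f j i').

(** On a tile where the codes differ, separation gives the full amount
[|S j| * e `^ p], from which only the points not owned by the tile are lost. *)
Lemma orbit_model_far b b' : 0 < e -> separated_nets ->
  b \in codes P (fun t => q t.1) -> b' \in codes P (fun t => q t.1) ->
  (\sum_(t in P | b t != b' t) #|` S t.1|%:R) * e `^ p <=
  \sum_(v : V) rho (orbit_model b v) (orbit_model b' v) `^ p + 2 * tau * k%:R * D `^ p.
Proof.
move=> e0 sep /codesP[bq _] /codesP[b'q _].
have DD : 0 <= D by exact: le_trans (rho0 x0 x0) (rhoD _ _).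
have Dp0 : 0 <= D `^ p by exact: powR_ge0.
rewrite (bigID (fun v => o v : bool))/= (tiling_sum _ T).
set A := \sum_(t in P) _; set B := \sum_(v | ~~ o v) _.
have B0 : 0 <= B by apply: sumr_ge0 => *; exact: powR_ge0.
suff : (\sum_(t in P | b t != b' t) #|` S t.1|%:R) * e `^ p <= A + tau * mass * D `^ p.
  have := ler_wpM2l (mulr_ge0 Dp0 (ltW tau0)) mass_le.
  by move: B0; lra.
have -> : tau * mass * D `^ p = \sum_(t in P) tau * #|` S t.1|%:R * D `^ p.
  by rewrite /mass mulr_sumr mulr_suml.
rewrite mulr_suml big_mkcondr/= -big_split; apply: ler_sum => -[j c] jcP /=.
have -> : \sum_(g <- S j | owns sv o j c g)
     rho (orbit_model b (sv g c)) (orbit_model b' (sv g c)) `^ p =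
   \sum_(g <- S j | owns sv o j c g)
     rho (act g (f j (b (j, c)))) (act g (f j (b' (j, c)))) `^ p.
  by apply: eq_bigr => g ow; rewrite !(orbit_model_owned _ ow).
case: ifPn => [bb'|_]; last first.
  apply: addr_ge0; first by apply: sumr_ge0 => *; exact: powR_ge0.
  by rewrite !mulr_ge0// ltW.
have : #|` S j|%:R * e `^ p <=
    \sum_(g <- S j) rho (act g (f j (b (j, c)))) (act g (f j (b' (j, c)))) `^ p.
  rewrite leNgt -rho_F_lt// -leNgt; apply: sep; [exact: bq jcP|exact: b'q jcP|].
  by move/val_inj/eqP; rewrite (negPf bb').
rewrite (bigID (owns sv o j c))/= => /le_trans; apply; rewrite lerD2l.
apply: (@le_trans _ _ (\sum_(g <- S j | ~~ owns sv o j c g) D `^ p)).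
  by apply: ler_sum => g _; apply: ge0_ler_powR; rewrite ?nnegrE ?(ltW p0).
rewrite -[X in \sum_(_ <- _ | _) X]mulr1 -mulr_sumr sum1_countr.
have := ler_wpM2l Dp0 (not_owned_le jcP); lra.
Qed.

Definition code_near (kappa : R) : rel {ffun J * V -> 'I_M.+1} := fun b b' =>
  \sum_(t in P | b t != b' t) #|` S t.1|%:R <= 8 * kappa * k%:R.

(** Codes near [b] are counted according to the set [Q] of tiles where they differ
from [b]: there are [2 ^ #|P|] sets, and for each of them the product over [Q] of
the numbers of choices. *)
Lemma ball_le (kappa : R) b : 0 <= u ->
  (forall j, (q j <= M.+1)%N) -> (forall j, (q j)%:R <= 2 * expR (u * #|` S j|%:R)) ->
  #|[set b' in codes P (fun t => q t.1) | code_near kappa b b']%SET|%:R <=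
  4 ^+ #|P| * expR (u * (8 * kappa * k%:R)).
Proof.
move=> u0 qM qexp; pose dif b' := [set t in P | b t != b' t]%SET.
set ball := [set b' in _ | _]%SET.
have fibre Q : #|[set b' in ball | dif b' == Q]%SET|%:R <=
    2 ^+ #|P| * expR (u * (8 * kappa * k%:R)).
  have [->|[b1]] := finset.set_0Vmem [set b' in ball | dif b' == Q]%SET.
    by rewrite cards0 mulr_ge0 ?exprn_ge0 ?expR_ge0.
  move=> /setIdP[/setIdP[_ near1] /eqP difQ].
  have QP : Q \subset P by rewrite -difQ; apply/fintype.subsetP => t; rewrite inE => /andP[].
  have Qmass : \sum_(t in Q) #|` S t.1|%:R <= 8 * kappa * k%:R.
    move: near1; rewrite /code_near; congr (_ <= _); rewrite -difQ.
    by apply: eq_bigl => t; rewrite inE.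
  (* On the fibre over Q, b' is determined by its values on Q. *)
  pose cut b' : {ffun J * V -> 'I_M.+1} := [ffun t => if t \in Q then b' t else ord0].
  have cut_inj : {in [set b' in ball | dif b' == Q]%SET &, injective cut}.
    move=> b2 b3 /setIdP[/setIdP[/codesP[_ o2] _] /eqP d2].
    move=> /setIdP[/setIdP[/codesP[_ o3] _] /eqP d3] /ffunP E.
    apply/ffunP => t; have [tP|tP] := boolP (t \in P); last by rewrite o2// o3.
    have [tQ|tQ] := boolP (t \in Q); first by have := E t; rewrite !ffunE tQ.
    move: (tQ); rewrite -{1}d2 inE tP/= negbK => /eqP <-.
    by move: tQ; rewrite -{1}d3 inE tP/= negbK => /eqP.
  rewrite -(card_in_imset cut_inj).
  apply: (@le_trans _ _ #|@codes _ M Q (fun t => q t.1)|%:R).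
    rewrite ler_nat; apply/subset_leq_card/fintype.subsetP => _ /imsetP[b2 b2B ->].
    move: b2B => /setIdP[/setIdP[/codesP[b2q _] _] _].
    apply/codesP; split => t tQ; rewrite ffunE; first by rewrite tQ b2q// (fintype.subsetP QP).
    by rewrite (negPf tQ).
  rewrite card_codes// natr_prod.
  apply: (@le_trans _ _ (\prod_(t in Q) (2 * expR (u * #|` S t.1|%:R)))).
    by apply: ler_prod => t _; rewrite ler0n qexp.
  rewrite big_split/= prodr_const -expR_sum -mulr_sumr.
  apply: ler_pM; rewrite ?exprn_ge0 ?expR_ge0//.
    by apply: ler_weXn2l; rewrite ?ler1n// subset_leq_card.
  by rewrite ler_expR ler_wpM2l.
have -> : #|ball|%:R = \sum_(Q in powerset P) #|[set b' in ball | dif b' == Q]%SET|%:R :> R.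
  rewrite -natr_sum -sum1_card (partition_big dif (mem (powerset P)))/=; last first.
    by move=> b' _; rewrite powersetE; apply/fintype.subsetP => t; rewrite inE => /andP[].
  by congr (_%:R); apply: eq_bigr => Q _; rewrite -sum1_card; apply: eq_bigl => b'; rewrite inE.
apply: le_trans (ler_sum _ (fun Q _ => fibre Q)) _.
by rewrite sumr_const card_powerset -[X in X <= _]mulr_natl natrX [leLHS]mulrA -exprMn -natrM.
Qed.

Lemma covnum_Map_ge (K : {fset G}) (delta kappa : R) :
  (0 < k)%N -> 0 < e -> 0 <= u -> 0 < kappa <= 4^-1 -> 0 < delta ->
  5 * tau * D `^ 2 < delta `^ 2 -> 2 * tau * D `^ p <= 4 * kappa * e `^ p ->
  (forall j, tau^-1 <= #|` S j|%:R) ->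
  (forall g, g \in K -> g \in L) -> (forall j g, g \in S j -> g \in L) ->
  (forall j g, g \in K ->
     (count (fun h => (g * h)%g \notin S j) (S j))%:R <= tau * #|` S j|%:R) ->
  separated_nets -> (forall j, (q j <= M.+1)%N) ->
  (forall j, expR (u * #|` S j|%:R) <= (q j)%:R <= 2 * expR (u * #|` S j|%:R)) ->
  ((expR (k%:R * (u * (1 - tau - 8 * kappa) - 4 * tau)))%:E <=
     covnum (@rho_l R X rho p k) (Map act rho K delta s) (kappa * e))%E.
Proof.
move=> k0 e0 u0 /andP[kap0 kap1] delta0 tauD2 tauDp Sbig KL SL inv sep qM qexp.
have q_le j : (q j)%:R <= 2 * expR (u * #|` S j|%:R) by case/andP: (qexp j).
have ep0 : 0 < e `^ p by exact: powR_gt0.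
apply: (@le_trans _ _ (#|@codes _ M P (fun t => q t.1)|%:R /
   (4 ^+ #|P| * expR (u * (8 * kappa * k%:R))))%:E); last first.
  apply: (@covnum_ge_packing _ _ _ _ _ _ _ orbit_model (fun=> x0) (code_near kappa)).
  - by rewrite mulr_gt0 ?exprn_gt0 ?expR_gt0.
  - by move=> b _; exact: orbit_model_Map.
  - by move=> b _; exact: ball_le.
  have ke0 : 0 < kappa * e by exact: mulr_gt0.
  have sum_lt (z y : 'I_k -> X) : rho_l rho p z y < kappa * e ->
      \sum_(v < k) rho (z v) (y v) `^ p < k%:R * (kappa * e) `^ p.
    by rewrite rho_l_lt.
  move=> b b' y bq b'q /sum_lt by_ /sum_lt b'y.
  rewrite /code_near -(ler_pM2r ep0); apply: le_trans (orbit_model_far e0 sep bq b'q) _.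
  have tri : \sum_(v : V) rho (orbit_model b v) (orbit_model b' v) `^ p <=
      k%:R * (4 * kappa * e `^ p).
    apply: (@le_trans _ _ (2 `^ p * (2 * (k%:R * (kappa * e) `^ p)))).
      apply: (@le_trans _ _ (2 `^ p * (\sum_(v < k) rho (orbit_model b v) (y v) `^ p +
                                       \sum_(v < k) rho (orbit_model b' v) (y v) `^ p))).
        rewrite -big_split mulr_sumr; apply: ler_sum => v _ /=.
        by rewrite (rhoC (orbit_model b' v)); exact: rho_powR_triangle.
      rewrite ler_wpM2l ?powR_ge0//; move: by_ b'y; lra.
    rewrite powRM ?(ltW kap0) ?(ltW e0)//.
    have p2 : 2 <= 2 `^ p :> R by apply: le1r_powR; rewrite ?ler1n.
    have : (4 * kappa) `^ p <= 4 * kappa.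
      apply: ge1r_powR => //; apply/andP; split; first by rewrite mulr_gt0.
      by move: kap1; rewrite -ler_pdivlMl ?mulr1.
    have -> : 4 * kappa = 2 * (2 * kappa) by rewrite mulrA -natrM.
    rewrite !powRM ?mulr_ge0 ?(ltW kap0)// => H.
    have kp0 : 0 <= kappa `^ p by exact: powR_ge0.
    set a := 2 `^ p in p2 H *; set x := kappa `^ p in kp0 H *.
    have H1 : a * 2 * x <= 2 * (2 * kappa).
      apply: le_trans H; rewrite -mulrA ler_wpM2l ?powR_ge0// ler_wpM2r//.
    have := ler_wpM2l (mulr_ge0 (ler0n R k) (ltW ep0)) H1.
    by move: (k%:R) (e `^ p) => n z; lra.
  have := ler_wpM2l (ler0n R k) tauDp.
  by move: tri; lra.
rewrite lee_fin ler_pdivlMr ?mulr_gt0 ?exprn_gt0 ?expR_gt0//.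
(* The tiles are large, hence few: #|P| <= 2 * tau * k. *)
have four : 4 ^+ #|P| <= expR (4 * tau * k%:R).
  have e4 : 4 <= expR 2 :> R.
    have e2 : 2 <= expR 1 :> R by exact: expR_ge1Dx.
    by rewrite -[2]/(1 + 1) expRD; move: e2; nra.
  apply: (@le_trans _ _ (expR 2 ^+ #|P|)); first by rewrite lerXn2r ?nnegrE ?expR_ge0.
  rewrite -expRM_natl ler_expR.
  have : #|P|%:R * tau^-1 <= mass.
    rewrite mulr_natl -sumr_const; apply: ler_sum => t _; exact: Sbig.
  rewrite ler_pdivrMr// => Pm.
  by have := ler_wpM2l (ltW tau0) mass_le; move: Pm; lra.
have codes_ge : expR (u * ((1 - tau) * k%:R)) <= #|@codes _ M P (fun t => q t.1)|%:R.
  rewrite card_codes// natr_prod.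
  apply: (@le_trans _ _ (\prod_(t in P) expR (u * #|` S t.1|%:R))).
    by rewrite -expR_sum -mulr_sumr ler_expR ler_wpM2l// mass_ge.
  by apply: ler_prod => t _; rewrite expR_ge0 /=; case/andP: (qexp t.1).
apply: le_trans codes_ge.
apply: (@le_trans _ _ (expR (k%:R * (u * (1 - tau - 8 * kappa) - 4 * tau)) *
   (expR (4 * tau * k%:R) * expR (u * (8 * kappa * k%:R))))).
  by rewrite ler_wpM2l ?expR_ge0// ler_wpM2r ?expR_ge0.
by rewrite -!expRD ler_expR; lra.
Qed.

End Model.
End Lower.
End Bounds.

(** * Upper and lower limits in the extended reals *)

Section Limits.
Context {R : realType}.
Local Open Scope ereal_scope.
Implicit Types (u : nat -> \bar R) (f : R -> \bar R) (a : \bar R).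

Lemma limn_esup_le u a : (\forall n \near \oo, u n <= a) -> limn_esup u <= a.
Proof.
move=> ua; rewrite /limn_esup limf_esupE.
apply: ge_ereal_inf; exists (ereal_sup (u @` [set n | u n <= a])).
  by exists [set n | u n <= a].
by apply: ub_ereal_sup => _ [n /= una <-].
Qed.

Lemma limn_esup_ge u a : frequently (fun n => a <= u n) -> a <= limn_esup u.
Proof.
move=> ua; rewrite /limn_esup limf_esupE; apply: le_ereal_inf_tmp => _ [V [N _ NV] <-].
have [n [Nn aun]] := ua N; apply: le_trans aun _.
by apply: ereal_sup_ubound; exists n => //; exact: NV.
Qed.

Lemma near_of_limn_esup_lt u a : limn_esup u < a -> \forall n \near \oo, u n < a.
Proof.
rewrite /limn_esup limf_esupE => /ereal_inf_lt[_ [V VN <-] supa].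
apply: filterS VN => n Vn; apply: le_lt_trans supa.
by apply: ereal_sup_ubound; exists n.
Qed.

Lemma frequently_of_limn_esup_gt u a : a < limn_esup u -> frequently (fun n => a < u n).
Proof.
move=> au N; apply: contrapT => /forallNP H; move: au; apply/negP; rewrite -leNgt.
apply: limn_esup_le; exists N => // n /= Nn; rewrite leNgt; apply/negP => aun.
by apply: (H n).
Qed.

Lemma limf_einf_ge f a (d : R) : (0 < d)%R ->
  (forall e : R, (0 < e < d)%R -> a <= f e) -> a <= limf_einf f (0%R : R)^'+.
Proof.
move=> d0 H; rewrite limf_einfE; apply: le_ereal_sup_tmp.
exists (ereal_inf (f @` [set e | a <= f e])).
  exists [set e | a <= f e] => //; near=> e; apply: H; apply/andP; split; near: e.
    exact: nbhs_right_gt.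
  exact: nbhs_right_lt.
by apply: le_ereal_inf_tmp => _ [e /= ae <-].
Unshelve. all: by end_near. Qed.

Lemma limf_einf_le f a : (forall d : R, (0 < d)%R ->
  exists2 e : R, (0 < e < d)%R & f e <= a) -> limf_einf f (0%R : R)^'+ <= a.
Proof.
move=> H; rewrite limf_einfE; apply: ub_ereal_sup => _ [A [d /= d0 dA] <-].
have [e /andP[e0 ed] fa] := H d d0; apply: le_trans fa; apply: ereal_inf_lbound.
exists e => //; apply: dA => //=; by rewrite sub0r normrN gtr0_norm.
Qed.

Lemma small_of_limf_einf_lt f a : limf_einf f (0%R : R)^'+ < a ->
  forall d : R, (0 < d)%R -> exists2 e : R, (0 < e < d)%R & f e < a.
Proof.
move=> fa d d0; apply: contrapT => H; move: fa; apply/negP; rewrite -leNgt.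
apply: limf_einf_ge d0 _ => e ed; rewrite leNgt; apply/negP => fea.
by apply: H; exists e.
Qed.

Lemma near_of_limf_einf_gt f a : a < limf_einf f (0%R : R)^'+ ->
  exists2 d : R, (0 < d)%R & forall e : R, (0 < e < d)%R -> a < f e.
Proof.
move=> fa; apply: contrapT => /forall2NP H; move: fa; apply/negP; rewrite -leNgt.
apply: limf_einf_le => d d0; have [//|{}H] := H d.
apply: contrapT => /forall2NP H'; apply: H => e ed; rewrite ltNge; apply/negP => fea.
by have [] := H' e.
Qed.

(** Comparing with real bounds only, with room [eps], avoids treating the infinite
values separately. *)
Lemma lee_of_real_above (x y : \bar R) :
  (forall (v eps : R), y < v%:E -> (0 < eps)%R -> x <= (v + eps)%:E) -> x <= y.
Proof.
case: y => [y||] H; last 2 first.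
- exact: leey.
- suff -> : x = -oo by [].
  apply: eq_ninfty => r; have := H (r - 1)%R 1%R (ltNyr _) ltr01.
  by rewrite subrK.
apply/lee_addgt0Pr => eps eps0; have e2 : (0 < eps / 2)%R by rewrite divr_gt0.
have := H (y + eps / 2)%R (eps / 2)%R; rewrite lte_fin ltrDl => /(_ e2 e2).
by rewrite -addrA -splitr.
Qed.

Lemma lee_of_real_below (x y : \bar R) :
  (forall (v eps : R), v%:E < x -> (0 < eps)%R -> (v - eps)%:E <= y) -> x <= y.
Proof.
move=> H; rewrite -leeN2; apply: lee_of_real_above => v eps yv eps0.
have := H (- v)%R eps; rewrite EFinN lteNl => /(_ yv eps0).
by rewrite -leeN2 -EFinN opprB opprK addrC.
Qed.

(** An inequality between normalized logarithms is an inequality between covering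
numbers, including the values [-oo] and [+oo]. *)
Lemma lne_ratio_le (c : \bar R) (a b : R) : 0 <= c -> (0 < b)%R ->
  (lne c / b%:E <= a%:E) = (c <= (expR (a * b))%:E).
Proof.
move=> c0 b0; rewrite inver gt_eqF// lee_pdivrMr// -EFinM.
by rewrite -(lee_expeR (lne c)) lneK// in_itv/= c0 leey.
Qed.

Lemma lne_ratio_ge (c : \bar R) (a b : R) : 0 <= c -> (0 < b)%R ->
  (a%:E <= lne c / b%:E) = ((expR (a * b))%:E <= c).
Proof.
move=> c0 b0; rewrite inver gt_eqF// lee_pdivlMr// -EFinM.
by rewrite -(lee_expeR _ (lne c)) lneK// in_itv/= c0 leey.
Qed.

Lemma ln_inv_gt0 (e : R) : (0 < e < 1)%R -> (0 < ln (1 / e))%R.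
Proof.
by move=> /andP[e0 e1]; rewrite ln_gt0// ltr_pdivlMr// mul1r.
Qed.

Lemma scale_below (d : R) : (0 < d)%R -> exists2 e : R, (0 < e < d)%R & (0 < e < 1)%R.
Proof.
move=> d0; have m0 : (0 < Num.min d 1)%R by rewrite lt_min d0 ltr01.
have : (Num.min d 1 / 2 < Num.min d 1)%R by move: m0; set m := Num.min d 1%R; lra.
by rewrite lt_min => /andP[ed e1]; exists (Num.min d 1 / 2)%R; apply/andP; split; rewrite ?divr_gt0.
Qed.

Lemma ln_inv_large (B : R) : exists2 e1 : R, (0 < e1 < 1)%R &
  forall e : R, (0 < e < e1)%R -> (B < ln (1 / e))%R.
Proof.
have [e1 /andP[e10 e1B] e11] := scale_below (expR_gt0 (- B)); exists e1 => // e /andP[e0].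
move=> /lt_trans/(_ e1B) eB.
by rewrite div1r lnV ?posrE// ltrNr -ltr_expR lnK.
Qed.

Lemma covnum_ge0 (T : Type) (r : T -> T -> R) (Y : set T) (e : R) : 0 <= covnum r Y e.
Proof. by apply: le_ereal_inf_tmp => _ [n _ <-]; rewrite lee_fin. Qed.

Lemma covnum_ge1 (T : Type) (r : T -> T -> R) (Y : set T) (e : R) (y : T) :
  Y y -> 1 <= covnum r Y e.
Proof.
move=> Yy; apply: (covnum_ge y) => n f [_ /(_ y Yy)[i ni _]].
by rewrite ler1n; exact: leq_ltn_trans ni.
Qed.

Lemma lne_covnum_empty (T : Type) (d : T -> T -> R) (Y : set T) (e a : R) :
  (forall y, ~ Y y) -> (0 < a)%R -> lne (covnum d Y e) / a%:E = -oo.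
Proof.
move=> Y0 a0; have -> : covnum d Y e = 0.
  apply/le_anti/andP; split; last by apply: le_ereal_inf_tmp => _ [n _ <-].
  apply: ereal_inf_lbound; exists 0%N => //; exists set0; split.
    by split => // y /Y0.
  by rewrite II0.
by rewrite le0_lneNy// inver gt_eqF// gt0_mulNye// lte_fin invr_gt0.
Qed.

End Limits.

(** * Sofic approximations from Folner sequences *)

(** Induction on [r]: a permutation that agrees with [f] on the tail of [r] is
corrected by the transposition that exchanges its value at [x] with [f x]. *)
Lemma perm_extend (T : finType) (f : T -> T) (r : seq T) :
  uniq r -> {in r &, injective f} -> exists sigma : {perm T}, {in r, sigma =1 f}.
Proof.
elim: r => [_ _|x r IH /= /andP[xr ur] finj]; first by exists 1%g => y; rewrite in_nil.
have [|sigma sf] := IH ur.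
  by move=> y z yr zr; apply: finj; rewrite inE ?yr ?zr orbT.
exists (sigma * tperm (sigma x) (f x))%g => y; rewrite inE permM => /orP[/eqP->|yr].
  by rewrite tpermL.
have yx : y != x by apply: contraNneq xr => <-.
rewrite tpermD; first exact: sf.
  by rewrite (inj_eq perm_inj) eq_sym.
rewrite sf//; apply: contraNneq yx => fxy.
by rewrite (finj x y) ?inE ?eqxx ?yr ?orbT.
Qed.

Lemma card_nth_count (T : eqType) (x0 : T) (Q : pred T) (r : seq T) (n : nat) :
  size r = n -> #|[pred k : 'I_n | Q (nth x0 r k)]| = count Q r.
Proof.
by move=> <-; rewrite -sum1_card -sum1_count (big_nth x0) big_mkord; apply: eq_bigl.
Qed.

Section FolnerSofic.
Context {R : realType} {G : groupType}.
Variable F : nat -> {fset G}.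
Hypothesis F_folner : folner_sequence R F.
Hypothesis G_infinite : infinite_set [set: G].

Let d n := #|` F n|.
Let elt n (k : 'I_(d n)) : G := nth 1%g (F n) k.

Lemma elt_inj n : injective (@elt n).
Proof. by move=> i j /eqP; rewrite nth_uniq ?fset_uniq// => /eqP/val_inj. Qed.

Lemma translation_perm n (g : G) : exists sigma : 'S_(d n), forall k : 'I_(d n),
  (g * elt k)%g \in F n -> elt (sigma k) = (g * elt k)%g.
Proof.
pose f (k : 'I_(d n)) : 'I_(d n) := insubd k (index (g * elt k)%g (F n)).
have fE k : (g * elt k)%g \in F n -> elt (f k) = (g * elt k)%g.
  by move=> gk; rewrite /elt /f insubdK ?nth_index//; rewrite -topredE /= index_mem.
have [|sigma sf] := @perm_extend _ f (enum [pred k | (g * elt k)%g \in F n]) (enum_uniq _).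
  move=> i j; rewrite !mem_enum !inE => gi gj /(congr1 (@elt n)).
  by rewrite !fE// => /mulgI/elt_inj.
by exists sigma => k gk; rewrite sf ?fE// mem_enum inE.
Qed.

(** Translation by [g] is defined on [F n] outside a set of vanishing proportion and
is injective there, so it extends to a permutation of an enumeration of [F n]. *)
Lemma sofic_exists : exists (d : nat -> nat) (sigma : forall i, G -> 'S_(d i)),
  sofic_approximation R d sigma.
Proof.
have perms : forall n, exists s : G -> 'S_(d n), forall g (k : 'I_(d n)),
    (g * elt k)%g \in F n -> elt (s g k) = (g * elt k)%g.
  by move=> n; have [s sP] := choice (translation_perm n); exists s.
pose sigma n := projT1 (cid (perms n)).
have sigmaP n : forall g (k : 'I_(d n)),
    (g * elt k)%g \in F n -> elt (sigma n g k) = (g * elt k)%g.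
  exact: projT2 (cid (perms n)).
pose bad n g : pred 'I_(d n) := [pred k | (g * elt k)%g \notin F n].
have dgt n : (0 < d n)%N := folner_gt0 F_folner n.
have cvg1 (A : forall n, pred 'I_(d n)) g h :
    (forall n k, ~~ bad n g k -> ~~ bad n h k -> A n k) ->
    (fun n => #|A n|%:R / (d n)%:R : R) @ \oo --> (1 : R).
  move=> sub; apply/cvgrPdist_le => e e0; have e2 : 0 < e / 2 by rewrite divr_gt0.
  near=> n.
  have bad_le x : x = g \/ x = h -> #|bad n x|%:R <= e / 2 * (d n)%:R.
    rewrite /bad (card_nth_count 1%g (fun f => (x * f)%g \notin F n) erefl).
    by case=> ->; near: n; exact: folner_shift.
  have : (d n <= #|A n| + (#|bad n g| + #|bad n h|))%N.
    rewrite -[X in (X <= _)%N]card_ord -(cardC (A n)) leq_add2l.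
    apply: leq_trans (_ : #|[predU bad n g & bad n h]| <= _)%N.
      apply/subset_leq_card/fintype.subsetP => k; rewrite !inE; apply: contraR.
      by rewrite negb_or => /andP[bg bh]; apply: sub.
    by rewrite -(cardUI (bad n g) (bad n h)) leq_addr.
  rewrite -(ler_nat R) !natrD; have := bad_le g (or_introl erefl).
  have := bad_le h (or_intror erefl).
  have : (#|A n|%:R <= (d n)%:R :> R) by rewrite ler_nat -[leqRHS]card_ord max_card.
  have d0 : 0 < (d n)%:R :> R by rewrite ltr0n.
  move: (#|A n|%:R) (#|bad n g|%:R) (#|bad n h|%:R) => a b c H1 H2 H3 H4.
  have -> : 1 - a / (d n)%:R = ((d n)%:R - a) / (d n)%:R by rewrite mulrBl divff ?gt_eqF.
  rewrite ger0_norm ?divr_ge0 ?subr_ge0 ?(ltW d0)//.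
  by rewrite ler_pdivrMr//; lra.
exists d, sigma; split.
- apply/cvgnyPge => m; exact: folner_size F_folner G_infinite m.
- move=> g h; apply: (cvg1 _ h (g * h)%g) => n k; rewrite !inE !negbK => hk ghk.
  apply/eqP/elt_inj; rewrite (sigmaP n (g * h)%g)// (sigmaP n g).
    by rewrite (sigmaP n h)// mulgA.
  by rewrite (sigmaP n h)// mulgA.
- move=> g h gh; apply: (cvg1 _ g h) => n k; rewrite !inE !negbK => gk hk.
  apply/eqP => /(congr1 (@elt n)); rewrite !sigmaP// => /mulIg.
  exact: gh.
Unshelve. all: by end_near. Qed.

End FolnerSofic.

(** * Bounds along a sofic approximation *)

Lemma small_exists (R : realType) (l : seq (R * R)) :
  (forall ab, ab \in l -> 0 <= ab.1 /\ 0 < ab.2) ->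
  exists2 t : R, 0 < t <= 2^-1 & forall ab, ab \in l -> t * ab.1 < ab.2.
Proof.
elim: l => [_|[a b] l IH H].
  by exists 2^-1 => //; rewrite lexx andbT.
have [t /andP[t0 t2] tP] : exists2 t : R, 0 < t <= 2^-1 & forall ab, ab \in l -> t * ab.1 < ab.2.
  by apply: IH => ab abl; apply: H; rewrite inE abl orbT.
have [/= a0 b0] := H (a, b) (mem_head _ _).
have c0 : 0 < b / (a + 1) by rewrite divr_gt0// ltr_wpDl.
exists (Num.min t (b / (a + 1))); first by rewrite lt_min t0 c0 ge_min t2.
move=> [a' b'] ab'; have /= [a'0 b'0] := H _ ab'.
move: ab'; rewrite inE => /orP[/eqP[-> ->]|/tP /=].
  apply: (@le_lt_trans _ _ (b / (a + 1) * a)); first by rewrite ler_wpM2r// ge_min lexx orbT.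
  by rewrite mulrAC ltr_pdivrMr ?ltr_wpDl// ltr_pM2l// ltrDl.
by apply: le_lt_trans; rewrite ler_wpM2r// ge_min lexx.
Qed.

Lemma nat_between (R : realType) (x : R) : 1 <= x -> exists q : nat,
  x <= q%:R <= 2 * x /\ forall n : nat, x <= n%:R -> (q <= n)%N.
Proof.
move=> x1; have ex : exists n : nat, x <= n%:R.
  by exists (Num.trunc x).+1; exact/ltW/truncnS_gt.
have [q xq qmin] := ex_minnP ex; exists q; split => //; rewrite xq /=.
case: q xq qmin => [|q] xq qmin; first by lra.
have : q%:R < x by rewrite ltNge; apply/negP => /qmin; rewrite ltnn.
by rewrite -natr1; lra.
Qed.

Section Asymptotics.
Context {R : realType} {G : groupType} {X : Type}.
Variables (act : G -> X -> X) (rho : X -> X -> R) (p D : R).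
Hypothesis rho_pm : is_pseudometric rho.
Hypothesis rhoD : forall x y, rho x y <= D.
Hypothesis p1 : 1 <= p.
Variables (x0 : X) (F : nat -> {fset G}).
Hypothesis F_folner : folner_sequence R F.
Hypothesis G_infinite : infinite_set [set: G].
Variables (d : nat -> nat) (sigma : forall i, G -> 'S_(d i)).
Hypothesis sofic : sofic_approximation R d sigma.

Let p0 : 0 < p. Proof. exact: lt_le_trans p1. Qed.
Let D0 : 0 <= D. Proof. by case: rho_pm => r0 _ _ _; exact: le_trans (r0 x0 x0) (rhoD _ _). Qed.

Lemma Map_sum_le (J : finType) (S : J -> {fset G}) (e : R) : 0 < e ->
  exists2 delta : R, 0 < delta & forall (k : nat) (s : G -> 'S_k) (K : {fset G}),
  (0 < k)%N -> (forall j g, g \in S j -> g \in K) ->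
  forall phi, Map act rho K delta s phi ->
   \sum_(j : J) \sum_(g <- S j) \sum_(c < k) rho (phi (s g c)) (act g (phi c)) `^ p
       <= k%:R * e `^ p.
Proof.
move=> e0; have ep0 : 0 < e `^ p by exact: powR_gt0.
pose m := (\sum_j #|` S j|)%N; pose eta := e `^ p / (2 * m.+1%:R).
have eta0 : 0 < eta by rewrite divr_gt0.
have [C C0 CP] := powR_le_square p0 D0 eta0.
have d20 : 0 < eta / (C + 1) by rewrite divr_gt0// ltr_wpDl.
exists (Num.sqrt (eta / (C + 1))); first by rewrite sqrtr_gt0.
move=> k s K k0 SK phi Mphi; have [r0 _ _ _] := rho_pm.
have one j g : g \in S j -> \sum_(c < k) rho (phi (s g c)) (act g (phi c)) `^ p <= k%:R * (2 * eta).
  move=> /SK /Mphi; rewrite /rho_l power_mean_lt//; first last.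
  - by apply: sumr_ge0 => *; exact: powR_ge0.
  - by rewrite sqrtr_gt0.
  rewrite (_ : _ `^ 2 = eta / (C + 1)); last first.
    by rewrite (powR_mulrn 2) ?sqrtr_ge0// sqr_sqrtr ?ltW.
  set Q := \sum_(_ < _) _ => Qlt.
  apply: (@le_trans _ _ (\sum_(c < k) (eta + C * rho (phi (s g c)) (act g (phi c)) `^ 2))).
    by apply: ler_sum => c _; rewrite (powR_mulrn 2)//; exact: CP.
  rewrite big_split/= sumr_const card_ord -mulr_sumr -/Q -[X in X + _]mulr_natl.
  have : C * Q <= k%:R * eta.
    apply: le_trans (ler_wpM2l C0 (ltW Qlt)) _; rewrite mulrCA ler_wpM2l//.
    by rewrite mulrCA ler_piMr ?(ltW eta0)// ler_pdivrMr ?ltr_wpDl// mul1r lerDl.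
  by lra.
apply: (@le_trans _ _ (\sum_(j : J) #|` S j|%:R * (k%:R * (2 * eta)))).
  apply: ler_sum => j _; rewrite big_seq.
  apply: le_trans (ler_sum _ (fun g gS => one j g gS)) _.
  by rewrite -big_seq big_const_seq count_predT iter_addr addr0 -[X in X <= _]mulr_natl.
rewrite -mulr_suml -natr_sum -/m mulrCA ler_wpM2l//.
have etaE : eta * (2 * m.+1%:R) = e `^ p by rewrite /eta divfK.
by move: etaE; rewrite -[m.+1%:R]natr1; move: eta0; lra.
Qed.

Lemma sofic_size_gt0 : \forall i \near \oo, (0 < d i)%N.
Proof. by case: sofic => /cvgnyPgt/(_ 0%N). Qed.

Lemma sofic_tiling (Q : nat -> Prop) (K : {fset G}) (tau : R) :
  frequently Q -> 0 < tau <= 2^-1 ->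
  exists (l : nat) (n : 'I_l -> nat) (L : {fset G}),
  [/\ forall j, [/\ Q (n j), tau^-1 <= #|` F (n j)|%:R &
        forall g, g \in K -> (count (fun f => (g * f)%g \notin F (n j)) (F (n j)))%:R
                          <= tau * #|` F (n j)|%:R],
      forall g, g \in K -> g \in L,
      forall j g, g \in F (n j) -> g \in L &
      \forall i \near \oo, (0 < d i)%N /\
        exists P o, tiling (fun g v => sigma i g v) (F \o n) tau
                      (good (fun g v => sigma i g v) L) P o /\
          #|uncovered o|%:R <= tau * (d i)%:R].
Proof.
move=> Qf ht; have [l [n [L [nQ KL FL tile]]]] := folner_tiling F_folner K G_infinite Qf ht.
have t4 : 0 < tau / 4 by case/andP: ht => ? _; rewrite divr_gt0.
exists l, n, L; split => //; have := sofic_good L sofic t4; have := sofic_size_gt0.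
apply: filterS2 => i di bad; split => //.
have [|P [ o [T un]]] := tile _ (fun g v => sigma i g v) (fun g => @perm_inj _ _).
  by rewrite card_ord.
by exists P, o; split; rewrite // card_ord in un.
Qed.

(** With tiles [F n] for which [covnum] is below [exp (v |F n|)], the number of codes
is at most [exp (v m)], where [m] is the sum of the sizes of the tiles, and
[m <= d_i / (1 - tau)]. *)
Lemma sofic_upper (v e eta : R) : 0 <= v -> 0 < e -> 0 < eta ->
  (\forall n \near \oo, (covnum (rho_F act rho (F n) p) [set: X] e <
                         (expR (v * #|` F n|%:R))%:E)%E) ->
  exists K delta, 0 < delta /\ \forall i \near \oo,
    (covnum (@rho_l R X rho p (d i)) (Map act rho K delta (sigma i)) (32 * e) <=
       (expR (v * (1 + eta) * (d i)%:R))%:E)%E.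
Proof.
move=> v0 e0 eta0 cov.
have ep0 : 0 < e `^ p by exact: powR_gt0.
have [|tau ht tauP] := @small_exists R [:: (D `^ p, e `^ p); (2, eta)].
  by move=> ab; rewrite !inE => /orP[/eqP->|/eqP->] /=; split; rewrite // powR_ge0.
have tD : tau * D `^ p < e `^ p by apply: (tauP (_, _)); rewrite inE eqxx.
have te : tau * 2 < eta by apply: (tauP (_, _)); rewrite !inE eqxx orbT.
have /andP[t0 t2] := ht.
have Qf : frequently (fun n => (covnum (rho_F act rho (F n) p) [set: X] e <
                         (expR (v * #|` F n|%:R))%:E)%E).
  have [N _ NP] := cov => m; exists (maxn m N); rewrite leq_maxl; split => //.
  by apply: NP; rewrite /= leq_maxr.
have [l [n [L [nP _ _ tile]]]] := sofic_tiling fset0 Qf ht.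
have /choice[Nf NfP] : forall j, exists Nf : nat * (nat -> X),
    (Nf.1)%:R < expR (v * #|` F (n j)|%:R) /\
    net (rho_F act rho (F (n j)) p) [set: X] e Nf.1 Nf.2.
  move=> j; have [/(covnum_lt_net x0)[N [f [Nv Nf]]] _ _] := nP j.
  by exists (N, f); rewrite -lte_fin.
have [delta delta0 deltaP] := Map_sum_le (F \o n) e0.
pose K := \big[fsetU/fset0]_(j : 'I_l) F (n j).
have FK j g : g \in F (n j) -> g \in K.
  by move=> gF; apply/bigfcupP; exists j; rewrite ?mem_index_enum.
exists K, delta; split => //; apply: filterS tile => i [di [P [ o [T un]]]].
apply: le_trans (covnum_Map_le (N := fun j => (Nf j).1) (f := fun j => (Nf j).2)
   (e := e) rho_pm rhoD p1 x0 di e0 t2 _ T _ _ _) _.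
- by move=> j; exact: folner_gt0 F_folner _.
- by move=> j; have [] := NfP j.
- apply: le_trans (ler_wpM2r (powR_ge0 _ _) un) _.
  by rewrite mulrAC mulrC ler_wpM2l// ltW.
- by apply: deltaP.
rewrite lee_fin natr_prod.
apply: (@le_trans _ _ (\prod_(t in P) expR (v * #|` F (n t.1)|%:R))).
  by apply: ler_prod => t _; rewrite ler0n ltW//; case: (NfP t.1).
rewrite -expR_sum -mulr_sumr ler_expR -mulrA ler_wpM2l//.
have := tiling_size_le T; rewrite card_ord /=; set Y := \sum_(t in P) _.
have : 0 <= Y by apply: sumr_ge0.
have : 0 <= (d i)%:R :> R by [].
move: t0 t2 te; set z := (d i)%:R; clear => t0 t2 te z0 Y0 H.
have : (1 + 2 * tau) * ((1 - tau) * Y) <= (1 + 2 * tau) * z by rewrite ler_wpM2l//; lra.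
have : 0 <= tau * (1 - 2 * tau) * Y by rewrite !mulr_ge0//; lra.
have : (1 + tau * 2) * z <= (1 + eta) * z by rewrite ler_wpM2r//; lra.
lra.
Qed.

(** Only infinitely many [n] need to satisfy the lower bound on [covnum], since the
tiles may all be taken among these Folner sets. *)
Lemma sofic_lower (u e eta kappa : R) :
  (forall g h x, act (g * h)%g x = act g (act h x)) ->
  0 <= u -> 0 < e -> 0 < eta -> 0 < kappa <= 4^-1 ->
  frequently (fun n => (expR (u * #|` F n|%:R))%:E <=
     covnum (rho_F act rho (F n) p) [set: X] e)%E ->
  forall K delta, 0 < delta -> \forall i \near \oo,
    ((expR ((d i)%:R * (u * (1 - 8 * kappa) - eta)))%:E <=
    covnum (@rho_l R X rho p (d i)) (Map act rho K delta (sigma i)) (kappa * e))%E.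
Proof.
move=> actM u0 e0 eta0 hk Qf K delta delta0; have /andP[k0 k1] := hk.
have ep0 : 0 < e `^ p by exact: powR_gt0.
have [|tau ht tauP] := @small_exists R
  [:: (5 * D `^ 2, delta `^ 2); (2 * D `^ p, 4 * kappa * e `^ p); (u + 4, eta)].
  move=> ab; rewrite !inE => /or3P[/eqP->|/eqP->|/eqP->] /=; split;
    rewrite ?mulr_ge0 ?mulr_gt0 ?powR_ge0 ?powR_gt0//.
  by rewrite addr_ge0.
have tD2 : tau * (5 * D `^ 2) < delta `^ 2 by apply: (tauP (_, _)); rewrite inE eqxx.
have tDp : tau * (2 * D `^ p) < 4 * kappa * e `^ p.
  by apply: (tauP (_, _)); rewrite !inE eqxx orbT.
have tu : tau * (u + 4) < eta by apply: (tauP (_, _)); rewrite !inE eqxx !orbT.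
have /andP[t0 t2] := ht.
have [l [n [L [nP KL FL tile]]]] := sofic_tiling K Qf ht.
have /choice[qf qfP] : forall j, exists qf : nat * (nat -> X),
    expR (u * #|` F (n j)|%:R) <= (qf.1)%:R <= 2 * expR (u * #|` F (n j)|%:R) /\
    forall i i', (i < qf.1)%N -> (i' < qf.1)%N -> i <> i' ->
      e <= rho_F act rho (F (n j)) p (qf.2 i) (qf.2 i').
  move=> j; have [cov _ _] := nP j.
  (* The least integer above the bound is still at most covnum, because
     cardinalities are integers. *)
  have [q [qexp qmin]] : exists q : nat,
      expR (u * #|` F (n j)|%:R) <= q%:R <= 2 * expR (u * #|` F (n j)|%:R) /\
      forall n0 : nat, expR (u * #|` F (n j)|%:R) <= n0%:R -> (q <= n0)%N.
    by apply: nat_between; rewrite -[leLHS]expR0 ler_expR mulr_ge0.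
  have [r0 rd rC _] := rho_pm.
  have [ | | | f fP] := @separated_of_covnum R X (rho_F act rho (F (n j)) p) e x0 q e0.
  - move=> x; rewrite /rho_F big1 ?mulr0 ?powR0 ?invr_eq0 ?gt_eqF//.
    by move=> g _; rewrite rd powR0 ?gt_eqF.
  - by move=> x y; rewrite /rho_F; congr (_ `^ _); congr (_ * _); apply: eq_bigr => g _; rewrite rC.
  - apply: (covnum_ge x0) => m f /covnum_le mf; rewrite ler_nat; apply: qmin.
    by rewrite -lee_fin; exact: le_trans cov mf.
  by exists (q, f).
pose M := (\max_(j < l) (qf j).1)%N.
have qM j : ((qf j).1 <= M.+1)%N by rewrite ltnW// ltnS; exact: leq_bigmax.
apply: filterS tile => i [di [P [ o [T un]]]].
apply: le_trans (covnum_Map_ge (q := fun j => (qf j).1) (f := fun j => (qf j).2)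
  (M := M) (u := u) (D := D) rho_pm rhoD p1 actM x0 T t0 t2 _ un di e0 u0 hk
  delta0 _ _ _ KL FL _ _ qM _).
- rewrite lee_fin ler_expR ler_wpM2l//; lra.
- by move=> j; exact: folner_gt0 F_folner _.
- by move: tD2; lra.
- by move: tDp; lra.
- by move=> j; have [] := nP j.
- by move=> j; have [] := nP j.
- by move=> j; have [] := qfP j.
- by move=> j; have [] := qfP j.
Qed.

End Asymptotics.

(** * Equality of the two mean dimensions *)

Section EmptySpace.
Context {R : realType} {G : groupType} {X : Type}.
Variables (act : G -> X -> X) (rho : X -> X -> R) (p : R).
Hypothesis X0 : X -> False.
Local Open Scope ereal_scope.

Lemma mdim_folner_empty (F : nat -> {fset G}) :
  folner_sequence R F -> mdim_folner act rho p F = -oo.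
Proof.
move=> Fol; apply/eqP; rewrite -leeNy_eq; apply: limf_einf_le => d d0.
have [e ed e1] := scale_below d0; exists e => //.
apply: limn_esup_le; near=> n; rewrite lne_covnum_empty// mulr_gt0//.
  by rewrite ltr0n; exact: folner_gt0 Fol _.
exact: ln_inv_gt0.
Unshelve. all: by end_near. Qed.

Lemma mdim_sofic_empty (d : nat -> nat) (sigma : forall i, G -> 'S_(d i)) :
  sofic_approximation R d sigma -> mdim_sofic act rho p sigma = -oo.
Proof.
move=> sof; apply/eqP; rewrite -leeNy_eq; apply: limf_einf_le => r r0.
have [e er e1] := scale_below r0; exists e => //.
apply: ge_ereal_inf; eexists; first by exists (fset0, 1%R); rewrite /= ?ltr01.
apply: limn_esup_le; have := sofic_size_gt0 sof; apply: filterS => i di.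
rewrite lne_covnum_empty//.
  by move=> phi; case: (X0 (phi (Ordinal di))).
rewrite mulr_gt0 ?ltr0n//.
exact: ln_inv_gt0.
Qed.
End EmptySpace.

Section MeanDimensionEquality.
Context {R : realType} {G : groupType} {X : Type}.
Variables (act : G -> X -> X) (rho : X -> X -> R) (p D : R).
Hypothesis actM : forall g h x, act (g * h)%g x = act g (act h x).
Hypothesis rho_pm : is_pseudometric rho.
Hypothesis rhoD : forall x y, rho x y <= D.
Hypothesis p1 : 1 <= p.
Variables (x0 : X) (F : nat -> {fset G}).
Hypothesis F_folner : folner_sequence R F.
Hypothesis G_infinite : infinite_set [set: G].
Variables (d : nat -> nat) (sigma : forall i, G -> 'S_(d i)).
Hypothesis sofic : sofic_approximation R d sigma.
Local Open Scope ereal_scope.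

(** A scale [e] at which the Folner side is below [v] yields the scale [32 * e] at
which the sofic side is below [v + eps]. *)
Lemma mdim_sofic_le_folner : mdim_sofic act rho p sigma <= mdim_folner act rho p F.
Proof.
apply: lee_of_real_above => v eps Fv eps0.
apply: limf_einf_le => r r0.
have [|eta /andP[eta0 eta2] etaP] := @small_exists R [:: (3 * `|v|, eps)%R].
  by move=> ab; rewrite inE => /eqP-> /=; split; rewrite ?mulr_ge0.
have etav : (eta * (3 * `|v|) < eps)%R by apply: (etaP (_, _)); rewrite inE eqxx.
(* This bound makes ln (1 / e) <= (1 + eta) * ln (1 / (32 * e)). *)
have [e1 /andP[e10 e11] Le] := ln_inv_large (ln 32 * (1 + eta) / eta)%R.
have m0 : (0 < Num.min e1 (Num.min r 1) / 32)%R by rewrite divr_gt0// !lt_min e10 r0 ltr01.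
have [e /andP[e0]] := small_of_limf_einf_lt Fv m0.
rewrite ltr_pdivlMr// mulrC !lt_min => /and3P[ee1 er e321] fe.
set e' := (32 * e)%R in ee1 er e321.
have e'0 : (0 < e')%R by rewrite mulr_gt0.
exists e'; first by rewrite e'0.
have ell : (0 < ln (1 / e'))%R by apply: ln_inv_gt0; rewrite e'0.
have L0 : (0 < ln (1 / e))%R by apply: ln_inv_gt0; rewrite e0 /= (le_lt_trans _ e321)// /e'; lra.
have Lell : (ln (1 / e) = ln 32 + ln (1 / e'))%R.
  by rewrite !div1r !lnV ?posrE// /e' lnM ?posrE//; lra.
have ell_big : (ln 32 <= eta * ln (1 / e'))%R.
  have l32 : (0 < ln 32 :> R)%R by rewrite ln_gt0// ltr1n.
  have := Le e'; rewrite e'0 ee1 => /(_ isT); rewrite ltr_pdivrMr//.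
  have := mulr_gt0 l32 eta0; lra.
set L := ln (1 / e)%R in L0 Lell fe *; set l := ln (1 / e')%R in ell Lell ell_big *.
have cov : \forall n \near \oo, covnum (rho_F act rho (F n) p) [set: X] e <
                         (expR (v * L * #|` F n|%:R))%:E.
  have := near_of_limn_esup_lt fe; apply: filterS => n; rewrite !ltNge; apply: contra.
  rewrite lne_ratio_ge ?covnum_ge0 ?mulr_gt0 ?ltr0n ?(folner_gt0 F_folner)//.
  by rewrite (mulrC (#|` F n|%:R)%R L) mulrA.
(* Covering numbers of the nonempty space X are at least 1. *)
have v0 : (0 <= v)%R.
  have [N _ /(_ N (leqnn N)) /=] := cov; move=> /(le_lt_trans (covnum_ge1 _ _ (y := x0) I)).
  rewrite lte_fin -[X in (X < _)%R]expR0 ltr_expR.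
  by rewrite !pmulr_lgt0 ?ltr0n ?(folner_gt0 F_folner)// => /ltW.
have [K [delta [delta0 covK]]] := sofic_upper rho_pm rhoD p1 x0 F_folner G_infinite sofic
   (mulr_ge0 v0 (ltW L0)) e0 eta0 cov.
apply: ge_ereal_inf; eexists; first by exists (K, delta).
apply: limn_esup_le; have := sofic_size_gt0 sofic; apply: filterS2 covK => i /= covi di.
rewrite lne_ratio_le ?covnum_ge0 ?mulr_gt0 ?ltr0n//; apply: le_trans covi _.
rewrite lee_fin ler_expR (mulrC (d i)%:R%R l) [leRHS]mulrA ler_wpM2r//.
have : (v * L * (1 + eta) <= v * ((1 + eta) * l) * (1 + eta))%R.
  rewrite ler_wpM2r ?addr_ge0 ?(ltW eta0)// ler_wpM2l// Lell; lra.
have : (v * (1 + eta) * (1 + eta) * l <= (v + eps) * l)%R.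
  rewrite ler_wpM2r ?(ltW ell)//; move: etav; rewrite ger0_norm// => etav.
  have : (eta * eta * v <= eta * v)%R by rewrite ler_wpM2r// ler_piMr ?(ltW eta0)//; lra.
  lra.
lra.
Qed.

(** The negative part of [u] is cut off because covering numbers of nonempty sets are
at least [1]. The factor [1 - 8 * kappa] and the change of scale by [kappa] each
cost at most [eps / 2]. *)
Lemma mdim_folner_le_sofic : mdim_folner act rho p F <= mdim_sofic act rho p sigma.
Proof.
apply: lee_of_real_below => u eps Fu eps0.
pose w := Num.max u 0%R; have w0 : (0 <= w)%R by rewrite le_max lexx orbT.
have uw : (u <= w)%R by rewrite le_max lexx.
have [|kappa /andP[kap0 kap2] kapP] := @small_exists R [:: (16 * w, eps)%R; (4, 1)%R].
  by move=> ab; rewrite !inE => /orP[/eqP->|/eqP->] /=; split; rewrite ?mulr_ge0.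
have kapw : (kappa * (16 * w) < eps)%R by apply: (kapP (_, _)); rewrite inE eqxx.
have kap4 : (kappa * 4 < 1)%R by apply: (kapP (_, _)); rewrite !inE eqxx orbT.
have [r r0 rP] := near_of_limf_einf_gt Fu.
have lk0 : (0 <= - ln kappa)%R by rewrite oppr_ge0 ln_le0//; lra.
have [e1 /andP[e10 e11] Le] := ln_inv_large (2 * (1 + w * - ln kappa) / eps)%R.
have d0 : (0 < kappa * Num.min e1 r)%R by rewrite mulr_gt0// lt_min e10.
apply: (@limf_einf_ge _ _ _ _ d0) => e' /andP[e'0 e'd].
pose e := (e' / kappa)%R; have e0 : (0 < e)%R by rewrite divr_gt0.
have e'E : e' = (kappa * e)%R by rewrite mulrC divfK ?gt_eqF.
have : (e < Num.min e1 r)%R by rewrite ltr_pdivrMr// mulrC.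
rewrite lt_min => /andP[ee1 er].
have fe : u%:E < _ := rP e (introT andP (conj e0 er)).
have L0 : (0 < ln (1 / e))%R by apply: ln_inv_gt0; rewrite e0 (lt_trans ee1).
have Lbig := Le e (introT andP (conj e0 ee1)).
have Lell : (ln (1 / e') = ln (1 / e) + - ln kappa)%R.
  by rewrite !div1r !lnV ?posrE// e'E lnM ?posrE//; lra.
set L := ln (1 / e)%R in L0 Lbig Lell fe *.
have cov : frequently (fun n => (expR (w * L * #|` F n|%:R))%:E <=
     covnum (rho_F act rho (F n) p) [set: X] e).
  have [u0|u0] := leP u 0%R.
    move=> m; exists m; split => //; rewrite /w max_r// !mul0r expR0.
    exact: covnum_ge1 (x0) _.
  move=> m; have [n [mn un]] := frequently_of_limn_esup_gt fe m; exists n; split => //.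
  have nL0 : (0 < #|` F n|%:R * L)%R by rewrite mulr_gt0 ?ltr0n ?(folner_gt0 F_folner).
  have := ltW un; rewrite lne_ratio_ge ?covnum_ge0//.
  by rewrite /w max_l ?(ltW u0)// (mulrC _ L) mulrA.
have hk : (0 < kappa <= 4^-1)%R by rewrite kap0; lra.
apply: le_ereal_inf_tmp => _ [[K delta] /= delta0 <-].
have low := sofic_lower rho_pm rhoD p1 x0 F_folner G_infinite sofic actM
  (mulr_ge0 w0 (ltW L0)) e0 ltr01 hk cov K delta0.
apply: limn_esup_ge => m.
have [N _ NP] := filterI (sofic_size_gt0 sofic) low.
exists (maxn m N); rewrite leq_maxl; split => //.
have [di lowi] := NP _ (leq_maxr m N).
have ell : (0 < ln (1 / e'))%R by rewrite Lell ltr_wpDr.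
rewrite lne_ratio_ge ?covnum_ge0 ?mulr_gt0 ?ltr0n//.
rewrite e'E; apply: le_trans lowi; rewrite -e'E lee_fin ler_expR.
rewrite mulrCA ler_wpM2l// Lell.
move: Lbig; rewrite ltr_pdivrMr// => Lbig.
have : (8 * kappa * w * L <= eps / 2 * L)%R by rewrite ler_wpM2r ?(ltW L0)//; lra.
have : ((u - eps) * (L + - ln kappa) <= (w - eps) * (L + - ln kappa))%R.
  by rewrite ler_wpM2r ?addr_ge0 ?(ltW L0)// lerD2r.
have := mulr_ge0 (ltW eps0) lk0.
move: Lbig; set c := (- ln kappa)%R; lra.
Qed.

End MeanDimensionEquality.

Lemma rho_bounded (R : realType) (X : topologicalType) (rho : X -> X -> R) :
  compact [set: X] -> continuous (fun xy : X * X => rho xy.1 xy.2) ->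
  exists D, forall x y, rho x y <= D.
Proof.
move=> Xc rhoc.
have := compact_setX Xc Xc; rewrite setXTT => XXc.
have /compact_bounded[M [_ MP]] : compact ((fun xy : X * X => rho xy.1 xy.2) @` [set: X * X]).
  by apply: continuous_compact => //; exact: continuous_subspaceT.
exists (M + 1) => x y; apply: le_trans (ler_norm _) _.
by apply: (MP (M + 1)); [rewrite ltrDl|exists (x, y)].
Qed.

Theorem theorem2p24 (R : realType) (G : groupType)
    (G_countable : countable [set: G])
    (G_infinite : infinite_set [set: G])
    (G_amenable : amenable R G)
    (X : topologicalType)
    (X_compact : compact [set: X])
    (X_metrizable : metrizable R X)
    (act : G -> X -> X)
    (act_homeo : acts_by_homeo act)
    (rho : X -> X -> R)
    (rho_pseudometric : is_pseudometric rho)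
    (rho_continuous : continuous (fun xy : X * X => rho xy.1 xy.2))
    (rho_generating : dynamically_generating act rho)
    (p : R) (p_ge1 : 1 <= p)
    (F : nat -> {fset G}) (F_folner : folner_sequence R F) :
  is_mdim act rho p (mdim_folner act rho p F) /\
  (forall F' : nat -> {fset G}, folner_sequence R F' ->
     mdim_folner act rho p F' = mdim_folner act rho p F).
Proof.
have [D rhoD] := rho_bounded X_compact rho_continuous.
have [_ actM _] := act_homeo.
have key F' : folner_sequence R F' -> forall d (sigma : forall i, G -> 'S_(d i)),
    sofic_approximation R d sigma ->
    mdim_sofic act rho p sigma = mdim_folner act rho p F'.
  move=> F'_folner d sigma sofic.
  have [[x0]|X0] := pselect (inhabited X).
    apply/le_anti/andP; split.
      exact: mdim_sofic_le_folner sofic.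
    exact: mdim_folner_le_sofic sofic.
  have X_empty : X -> False by move=> x; apply: X0; exact: inhabits.
  by rewrite mdim_sofic_empty// mdim_folner_empty.
have [d [sigma sofic]] := sofic_exists F_folner G_infinite.
split; first by split; [exists d, sigma|exact: key].
by move=> F' F'_folner; rewrite -(key F' F'_folner _ _ sofic) (key F).
Qed.
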